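(* Let $C=\mathbb C$, $F=\mathbb C(t)$, let $q$ be a primitive $n$-th root of unity ($n\ge2$) and let $a\in\mathbb C$. Consider the rank-one iterative $q$-difference equation over $F$ $$\delta^{(1)}(y)=0,\qquad \delta^{(n)}(y)=\frac{a}{n\,t^n}\,y,$$ (the equation of the rank-one iterative $q$-difference module $M=Fb_1$ with $\phi_M(b_1)=b_1$) and let $E/F$ be an iterative $q$-difference Picard–Vessiot extension for it. Then $\underline{Gal}(E/F)$ is a finite cyclic group if $a\in\mathbb Q$, and $\underline{Gal}(E/F)\cong\mathbb G_m$ if $a\notin\mathbb Q$.
   Context: $\sigma_q(f(t))=f(qt)$ on $F$; $\binom{r}{k}_q$ denotes the value at $q$ of the Gaussian polynomial $\prod_{i=1}^{k}\frac{1-x^{r-i+1}}{1-x^{i}}$. $F$ is an iterative $q$-difference field via $\delta^{(k)}(\lambda t^r)=\lambda\binom{r}{k}_qt^{r-k}$, extended additively to $\mathbb C[t]$ and to $F$ by $\delta^{(k)}(ab)=\sum_{i+j=k}\sigma_q^i(\delta^{(j)}(a))\delta^{(i)}(b)$. An $ID_q$-ring is a commutative $F$-algebra $R$ with an automorphism $\sigma_q$ extending that of $F$ and maps $\delta_R^{(k)}$ with $\delta_R^{(0)}=\mathrm{id}$, $\delta_R^{(1)}=\frac{\sigma_q-\mathrm{id}}{(q-1)t}$, additivity, $\delta_R^{(k)}(ab)=\sum_{i+j=k}\sigma_q^i(\delta_R^{(j)}(a))\delta_R^{(i)}(b)$, $\delta_R^{(i)}\circ\delta_R^{(j)}=\binom{i+j}{i}_q\delta_R^{(i+j)}$;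 constants $C(R)$ are elements killed by all $\delta_R^{(k)}$, $k\ge1$; $ID_q$-simple means no ideals stable under all $\delta_R^{(k)}$ other than $0,R$. (In characteristic $0$ the operators $\delta^{(1)}$ and $\delta^{(n)}$ determine all the others, so the equation above is the full iterative $q$-difference equation.) An iterative $q$-difference Picard–Vessiot ring for the equation is an $ID_q$-simple $ID_q$-ring $R\supseteq F$ with $C(R)=\mathbb C$, generated over $F$ by a solution $y\in R^\times$ and $y^{-1}$; $E$ is its localization at non-zero divisors, and $\underline{Gal}(E/F)$ is the functor sending a $\mathbb C$-algebra $A$ to the group of $F\otimes A$-algebra automorphisms of $R\otimes_{\mathbb C}A$ commuting with $\delta^{(k)}(r\otimes c)=\delta_R^{(k)}(r)\otimes c$. *)

(* Defs.v *)
From mathcomp Require Import all_boot all_order all_algebra.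
From mathcomp.real_closed Require Import complex.
From mathcomp Require Import Rstruct.
Set Implicit Arguments.
Unset Strict Implicit.
Unset Printing Implicit Defensive.
Import GRing.Theory.
Local Open Scope ring_scope.
Notation "x %:F" := (@FracField.tofrac _ x) : ring_scope.

Definition C : numClosedFieldType := complex Rdefinitions.R.
Definition F : fieldType := {fraction {poly C}}.
Definition cF (c : C) : F := (c%:P)%:F.
Definition tF : F := ('X)%:F.

(* Value at q of the Gaussian polynomial prod_{i=1}^k (1-x^(r-i+1))/(1-x^i)
   (an exact polynomial quotient). *)
Definition qbinom (q : C) (r k : nat) : C :=
  ((\prod_(1 <= i < k.+1) (1 - 'X^(r - i + 1)%N))
     %/ (\prod_(1 <= i < k.+1) (1 - 'X^i)) : {poly C}).[q].

(* delta^(k) on C[t]: delta^(k)(lambda t^r) = lambda [r choose k]_q t^(r-k),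
   extended additively. *)
Definition dpoly (q : C) (k : nat) (p : {poly C}) : {poly C} :=
  \poly_(i < size p) (p`_(i + k) * qbinom q (i + k) k).

Definition is_ring_hom (A B : nzRingType) (f : A -> B) : Prop :=
  [/\ forall x y, f (x + y) = f x + f y,
      forall x y, f (x * y) = f x * f y & f 1 = 1].

(* ID_q-ring structure (sigma, delta^(k)) on a commutative F-algebra R,
   extending the iterative q-difference structure of F = C(t)
   (given on C[t]; on F it is then determined by the Leibniz rule). *)
Record IDq_ring (q : C) (R : comAlgType F) (s : R -> R) (d : nat -> R -> R)
  : Prop := {
  s_hom : is_ring_hom s;
  s_bij : bijective s;
  s_ext : forall p : {poly C}, s ((p%:F)%:A) = ((p \Po (q%:P * 'X))%:F)%:A;
  d_0 : forall r, d 0%N r = r;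
  d_1 : forall r, d 1%N r = ((cF (q - 1) * tF)^-1)%:A * (s r - r);
  d_add : forall k x y, d k (x + y) = d k x + d k y;
  d_mul : forall k x y,
     d k (x * y) = \sum_(i < k.+1) iter i s (d (k - i)%N x) * d i y;
  d_comp : forall i j r, d i (d j r) = (cF (qbinom q (i + j) i))%:A * d (i + j)%N r;
  d_ext : forall k (p : {poly C}), d k ((p%:F)%:A) = ((dpoly q k p)%:F)%:A
}.

Definition IDq_simple (R : comAlgType F) (d : nat -> R -> R) : Prop :=
  forall I : R -> Prop,
    I 0 -> (forall x y, I x -> I y -> I (x - y)) ->
    (forall r x, I x -> I (r * x)) -> (forall k x, I x -> I (d k x)) ->
    (forall x, I x -> x = 0) \/ (forall x, I x).

Definition IDq_constants_C (R : comAlgType F) (d : nat -> R -> R) : Prop :=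
  forall r, (forall k, (0 < k)%N -> d k r = 0) -> exists c : C, r = (cF c)%:A.

Record PV_ring (q : C) (n : nat) (a : C) (R : comAlgType F) (s : R -> R)
  (d : nat -> R -> R) (y : R) : Prop := {
  pv_IDq : IDq_ring q s d;
  pv_simple : IDq_simple d;
  pv_const : IDq_constants_C d;
  pv_sol1 : d 1%N y = 0;
  pv_soln : d n y = ((cF a / (n%:R * tF ^+ n))%:A) * y;
  pv_gen : exists z : R, y * z = 1 /\
     forall r : R, exists (N : nat) (f : nat -> nat -> F),
       r = \sum_(i < N) \sum_(j < N) (f i j)%:A * y ^+ i * z ^+ j
}.

(* A tensor product R (x)_C A of commutative C-algebras, given by its
   universal property (coproduct of commutative C-algebras). *)
Record tensor (R : comAlgType F) (A : comAlgType C) := {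
  tT :> comNzRingType;
  tR : R -> tT;
  tA : A -> tT;
  tR_hom : is_ring_hom tR;
  tA_hom : is_ring_hom tA;
  t_compat : forall c : C, tR ((cF c)%:A) = tA (c%:A);
  t_univ : forall (S : comNzRingType) (u : R -> S) (v : A -> S),
    is_ring_hom u -> is_ring_hom v ->
    (forall c : C, u ((cF c)%:A) = v (c%:A)) ->
    exists h : tT -> S, [/\ is_ring_hom h, (forall r, h (tR r) = u r),
      (forall x, h (tA x) = v x) &
      (forall h' : tT -> S, is_ring_hom h' -> (forall r, h' (tR r) = u r) ->
         (forall x, h' (tA x) = v x) -> forall t, h' t = h t)]
}.

(* Gal(E/F)(A): F (x) A-algebra automorphisms of R (x) A commuting with
   delta^(k) (r (x) c) = delta_R^(k)(r) (x) c. *)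
Definition in_Gal (R : comAlgType F) (d : nat -> R -> R) (A : comAlgType C)
  (T : tensor R A) (g : T -> T) : Prop :=
  [/\ is_ring_hom g, bijective g,
      (forall f : F, g (tR T (f%:A)) = tR T (f%:A)),
      (forall x : A, g (tA T x) = tA T x) &
      (forall (k : nat) (D : T -> T), (forall x y, D (x + y) = D x + D y) ->
         (forall r c, D (tR T r * tA T c) = tR T (d k r) * tA T c) ->
         forall x, D (g x) = g (D x))].

(* Natural isomorphism of group functors between Gal(E/F) and the subgroup
   functor A |-> {c in A | P A c} of the units (group law: multiplication). *)
Definition Gal_iso (R : comAlgType F) (d : nat -> R -> R)
  (P : forall A : comAlgType C, A -> Prop) : Prop :=
  exists Phi : forall (A : comAlgType C) (T : tensor R A), (T -> T) -> A,
  [/\ (forall A T g, in_Gal d g -> P A (Phi A T g)),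
      (forall A T g h, in_Gal d g -> in_Gal d h ->
          Phi A T (g \o h) = Phi A T g * Phi A T h),
      (forall A T g h, in_Gal d g -> in_Gal d h ->
          Phi A T g = Phi A T h -> forall x, g x = h x),
      (forall A T c, P A c -> exists g, in_Gal d g /\ Phi A T g = c) &
      (forall (A B : comAlgType C) (f : A -> B), is_ring_hom f ->
         (forall c : C, f (c%:A) = c%:A) ->
         forall (TA : tensor R A) (TB : tensor R B) (phi : TA -> TB),
         is_ring_hom phi -> (forall r, phi (tR TA r) = tR TB r) ->
         (forall x, phi (tA TA x) = tA TB (f x)) ->
         forall (g : TA -> TA) (g' : TB -> TB), in_Gal d g -> in_Gal d g' ->
         (forall t, g' (phi t) = phi (g t)) ->
         Phi B TB g' = f (Phi A TA g))].

(* Main.v *)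
(* Since q has order n, d^(1) and d^(n) generate all d^(k), and the ID_q-structure of R amounts
   to the automorphism s together with the Euler operator th = n t^n d^(n) + sum_i i P_i, where
   P_i is the projection onto the q^i-eigenspace of s.  The operator th is a genuine derivation,
   restricts to t d/dt on F, and s y = y, th y = a y.  A shortest F-linear relation between powers
   of y has constant coefficients up to monomials, so it forces some y^j into F; comparing leading
   coefficients in t f' = a j f shows that a j is then an integer divisible by n.  So either a is
   irrational and y is transcendental over F, or a / n = p / m in lowest terms and
   R = F[X] / (X^m - c t^(n p)).
   Both s and th extend to R (x) A (th through dual numbers), and by simplicity of R the common
   constants of the extensions are A, provided A embeds in R (x) A; this last point follows from
   evaluating rational functions at large integers, with values in the germs at infinity of
   sequences in A.  Hence an automorphism g is determined by the constant g(y) / y in A. *)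

Require Import Defs.
From HB Require Import structures.
From mathcomp Require Import all_boot all_order all_algebra.
From mathcomp Require Import zify ring.
From mathcomp Require Import boolp classical_sets functions.
Set Implicit Arguments.
Unset Strict Implicit.
Unset Printing Implicit Defensive.
Import GRing.Theory Num.Theory.
Local Open Scope ring_scope.

(** * Subrings, dual numbers and germs *)

Section Subring.
Variables (T : comNzRingType) (P : T -> Prop).
Hypotheses (P1 : P 1) (PB : forall x y, P x -> P y -> P (x - y))
  (PM : forall x y, P x -> P y -> P (x * y)).

Definition subring_pred : {pred T} := fun x => `[< P x >].

Lemma subring_pred_closed : subring_closed subring_pred.
Proof.
split; first exact/asboolP.
- by move=> x y /asboolP Px /asboolP Py; apply/asboolP/PB.
- by move=> x y /asboolP Px /asboolP Py; apply/asboolP/PM.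
Qed.

HB.instance Definition _ :=
  GRing.isSubringClosed.Build T subring_pred subring_pred_closed.

Definition subring_type := {x : T | subring_pred x}.
HB.instance Definition _ := SubType.copy subring_type {x : T | subring_pred x}.
HB.instance Definition _ := [Choice of subring_type by <:].
HB.instance Definition _ := [SubChoice_isSubComNzRing of subring_type by <:].

(** The universal property of a tensor product quantifies over ring types, so a closed predicate
    must become a ring before it can serve as a target. *)
Lemma subring_exists : exists (S : comNzRingType) (i : {rmorphism S -> T}),
  [/\ injective i, forall x, P (i x) & forall x, P x -> exists z, i z = x].
Proof.
exists subring_type, (val : {rmorphism subring_type -> T}); split.
- exact: val_inj.
- by move=> x; apply/asboolP/(valP x).
- by move=> x Px; exists (exist _ x (introT (asboolP _) Px)).
Qed.

End Subring.

(** An alias of the pair type, so that the dual-number product does not compete with the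
    componentwise one. *)
Definition dual_numbers (T : Type) := (T * T)%type.

Section DualNumbers.
Variable T : comNzRingType.

HB.instance Definition _ := GRing.Zmodule.copy (dual_numbers T) (T * T)%type.

Let dual_one : dual_numbers T := (1, 0).
Let dual_mul (x y : dual_numbers T) : dual_numbers T :=
  (x.1 * y.1, x.1 * y.2 + x.2 * y.1).

Lemma dual_mulA : associative dual_mul.
Proof.
move=> [a b] [c d] [e f]; rewrite /dual_mul /=; congr (_, _).
  by rewrite mulrA.
by rewrite !mulrDr !mulrDl !mulrA addrA.
Qed.

Lemma dual_mulC : commutative dual_mul.
Proof.
move=> [a b] [c d]; rewrite /dual_mul /=; congr (_, _); first by rewrite mulrC.
by rewrite addrC mulrC [a * d]mulrC.
Qed.

Lemma dual_mul1 : left_id dual_one dual_mul.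
Proof. by move=> [a b]; rewrite /dual_mul /= !mul1r mul0r addr0. Qed.

Lemma dual_mulDl : left_distributive dual_mul +%R.
Proof.
move=> [a b] [c d] [e f]; rewrite /dual_mul /=; congr (_, _).
  by rewrite mulrDl.
by rewrite !mulrDl !addrA; congr (_ + _); rewrite -!addrA [_ + b * e]addrC.
Qed.

Lemma dual_one_neq0 : dual_one != 0.
Proof. by apply/eqP => -[/eqP]; rewrite oner_eq0. Qed.

HB.instance Definition _ := GRing.Zmodule_isComNzRing.Build (dual_numbers T)
  dual_mulA dual_mulC dual_mul1 dual_mulDl dual_one_neq0.

Lemma dual_mulE (x y : dual_numbers T) :
  x * y = (x.1 * y.1, x.1 * y.2 + x.2 * y.1).
Proof. by []. Qed.

End DualNumbers.

Section Germs.
Variable A : comNzRingType.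

Definition eventually0 : {pred nat -> A} :=
  fun f => `[< exists N, forall i, (N <= i)%N -> f i = 0 >].

Lemma eventually0_ideal : idealr_closed eventually0.
Proof.
split; first by apply/asboolP; exists 0%N.
  apply/asboolP => -[N] /(_ N (leqnn N)) /eqP.
  by rewrite [X in X == _](_ : _ = 1) ?oner_eq0.
move=> h f g /asboolP[N fN] /asboolP[M gM]; apply/asboolP; exists (maxn N M) => i.
by rewrite geq_max => /andP[/fN fi /gM gi]; rewrite !fctE fi gi mulr0 addr0.
Qed.

HB.instance Definition _ := isIdealr.Build (nat -> A) eventually0 eventually0_ideal.

(** Germs at infinity of sequences in [A]; constant sequences embed [A]. *)
Definition germs : comNzRingType := {ideal_quot eventually0}.
Definition germ (f : nat -> A) : germs := (\pi f)%qT.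

Lemma germ_is_zmod_morphism : zmod_morphism germ.
Proof. by move=> f g; rewrite /germ rmorphB. Qed.
Lemma germ_is_monoid_morphism : monoid_morphism germ.
Proof. by split=> [|f g]; rewrite /germ ?rmorph1 ?rmorphM. Qed.
HB.instance Definition _ := GRing.isZmodMorphism.Build _ _ germ germ_is_zmod_morphism.
HB.instance Definition _ := GRing.isMonoidMorphism.Build _ _ germ germ_is_monoid_morphism.

Lemma germP (f g : nat -> A) :
  (exists N, forall i, (N <= i)%N -> f i = g i) <-> germ f = germ g.
Proof.
split=> [[N fg]|/eqP].
  apply/eqP; rewrite -Quotient.idealrBE; apply/asboolP; exists N => i /fg E.
  by rewrite !fctE E subrr.
rewrite -Quotient.idealrBE => /asboolP[N fg]; exists N => i /fg.
by rewrite !fctE => /eqP; rewrite subr_eq0 => /eqP.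
Qed.

End Germs.

(* Otherwise unification unfolds C and loses its canonical structures. *)
Local Opaque C.

(** * Rational functions evaluated at large integers *)

Lemma fraction_reprE (D : idomainType) (f : {fraction D}) :
  f = (\n_(repr f))%:F / (\d_(repr f))%:F.
Proof.
apply: canRL (mulfK _) _; first by rewrite tofrac_eq0 denom_ratioP.
have -> : f * (\d_(repr f))%:F = (\pi_({fraction D}) (repr f))%qT * (\d_(repr f))%:F.
  by rewrite reprK.
move: (repr f) => x.
unlock FracField.tofrac; rewrite !piE; apply/eqmodP.
rewrite /= FracField.equivfE /FracField.mulf.
by rewrite !numden_Ratio ?mulr1 ?oner_eq0 ?denom_ratioP // mulrC.
Qed.

(** The value uses the representative chosen by [repr], with the convention x / 0 = 0, so it is
    compatible with the field operations only away from finitely many points. *)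
Definition evalF (f : F) (x : C) : C :=
  (\n_(repr f) : {poly C}).[x] / (\d_(repr f) : {poly C}).[x].

(** The polynomial splits over [C], and each linear factor excludes at most one natural number. *)
Lemma eventually_nonroot (p : {poly C}) :
  p != 0 -> exists N, forall i, (N <= i)%N -> p.[i%:R] != 0.
Proof.
have [rs ->] := closed_field_poly_normal p.
rewrite scaler_eq0 negb_or lead_coef_eq0 => /andP[p0 _].
elim: rs => [|x rs [N IH]].
  by exists 0%N => i _; rewrite big_nil hornerZ hornerC mulr1 lead_coef_eq0.
have [M HM] : exists M, forall i, (M <= i)%N -> i%:R != x.
  have [[j jx]|nx] := pselect (exists j : nat, j%:R = x); last first.
    by exists 0%N => i _; apply/eqP => ix; apply: nx; exists i.
  by exists j.+1 => i ji; rewrite -jx eqr_nat gtn_eqF.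
exists (maxn N M) => i; rewrite geq_max => /andP[/IH + /HM].
rewrite big_cons !hornerZ hornerM hornerXsubC !mulf_eq0 !negb_or subr_eq0.
by move=> /andP[-> ->] ->.
Qed.

Lemma den_neq0 (f : F) : (\d_(repr f) : {poly C}) != 0.
Proof. exact: denom_ratioP. Qed.

Lemma evalF_frac (f : F) (p r : {poly C}) : r != 0 -> f = p%:F / r%:F ->
  exists N, forall i, (N <= i)%N -> r.[i%:R] != 0 /\ evalF f i%:R = p.[i%:R] / r.[i%:R].
Proof.
move=> r0 fE.
have [N rN] := eventually_nonroot r0.
have [M dM] := eventually_nonroot (den_neq0 f).
exists (maxn N M) => i; rewrite geq_max => /andP[/rN ri /dM di]; split=> //.
apply/eqP; rewrite eqr_div //; apply/eqP.
have : (\n_(repr f) : {poly C}) * r = p * \d_(repr f).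
  apply/eqP; rewrite -tofrac_eq !tofracM -eqr_div ?tofrac_eq0 ?den_neq0 //.
  by rewrite -fE -fraction_reprE.
by move=> /(congr1 (fun p => p.[i%:R])); rewrite !hornerM.
Qed.

Section GermF.
Variable A : comAlgType C.

(* The natural numbers serve as points of the line: a rational function is defined at all but
   finitely many of them, so it has a germ at infinity although no pole-free evaluation exists. *)
Definition germF (f : F) : germs A := germ (fun i => (evalF f i%:R)%:A).

Lemma germF_frac (f : F) (p r : {poly C}) : r != 0 -> f = p%:F / r%:F ->
  germF f = germ (fun i => (p.[i%:R] / r.[i%:R])%:A).
Proof.
move=> r0 /(evalF_frac r0)[N fN]; apply/germP; exists N => i /fN[_ -> //].
Qed.

Lemma germF_is_zmod_morphism : zmod_morphism germF.
Proof.
move=> f g; set p := \n_(repr f); set r := \d_(repr f).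
set p' := \n_(repr g); set r' := \d_(repr g).
have r0 : r != 0 by exact: den_neq0.
have r0' : r' != 0 by exact: den_neq0.
rewrite (@germF_frac (f - g) (p * r' - p' * r) (r * r')).
- rewrite /germF -rmorphB; apply/germP.
  have [N rN] := eventually_nonroot r0; have [M rM] := eventually_nonroot r0'.
  exists (maxn N M) => i; rewrite geq_max => /andP[/rN ri /rM ri'].
  rewrite [RHS](_ : _ = (evalF f i%:R - evalF g i%:R)%:A); last by rewrite scalerBl.
  by rewrite /evalF -/p -/r -/p' -/r' hornerD hornerN !hornerM -[- (_ / _)]mulNr addf_div // mulNr.
- by rewrite mulf_neq0.
- rewrite [f]fraction_reprE [g in LHS]fraction_reprE -/p -/r -/p' -/r'.
  by rewrite -mulNr addf_div ?tofrac_eq0 // mulNr tofracB !tofracM.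
Qed.

Lemma germF_cF (c : C) : germF (cF c) = germ (fun=> c%:A).
Proof.
rewrite (@germF_frac _ c%:P 1) ?oner_eq0 ?tofrac1 ?divr1 //.
by congr germ; apply/funext => i; rewrite !hornerE divr1.
Qed.

Lemma germF_is_monoid_morphism : monoid_morphism germF.
Proof.
have c1 : cF 1 = 1 by rewrite /cF polyC1 tofrac1.
split.
  rewrite -c1 germF_cF -[RHS](rmorph1 (@germ A)).
  by congr germ; apply/funext => i; rewrite scale1r.
move=> f g; set p := \n_(repr f); set r := \d_(repr f).
set p' := \n_(repr g); set r' := \d_(repr g).
have r0 : r != 0 by exact: den_neq0.
have r0' : r' != 0 by exact: den_neq0.
rewrite (@germF_frac (f * g) (p * p') (r * r')).
- rewrite /germF -(rmorphM (@germ A)); apply/germP; exists 0%N => i _.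
  by rewrite fctE /evalF -/p -/r -/p' -/r' !hornerM -mulf_div -scalerAl mul1r scalerA.
- by rewrite mulf_neq0.
- rewrite [f]fraction_reprE [g in LHS]fraction_reprE -/p -/r -/p' -/r'.
  by rewrite mulf_div !tofracM.
Qed.

HB.instance Definition _ := GRing.isZmodMorphism.Build _ _ germF germF_is_zmod_morphism.
HB.instance Definition _ := GRing.isMonoidMorphism.Build _ _ germF germF_is_monoid_morphism.

(** Roots are taken pointwise: sequences are arbitrary, so no coherent choice of branch is required.
    Such a root will be the image of [y] when [y ^+ m] lies in F. *)
Lemma germF_root (m : nat) (b : F) : (0 < m)%N ->
  exists eta : germs A, eta ^+ m = germF b.
Proof.
move=> m0; exists (germ (fun i => (m.-root (evalF b i%:R))%:A)).
rewrite -rmorphXn; apply: (congr1 (@germ A)); apply/funext => i.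
by rewrite fctE exprZn expr1n rootCK.
Qed.

End GermF.

(** * Gaussian binomials at a root of unity *)

Section QBinomial.

Let f (j : nat) : {poly C} := 1 - 'X^j.

(** The q-Pascal recurrence, coming from f (b+k+2) = f (k+1) + X^(k+1) f (b+1). It makes the
    polynomial quotient in [qbinom] exact. *)
Lemma gauss_divides (b k : nat) : exists G : {poly C},
  \prod_(i < k) f (b + i.+1) = G * \prod_(i < k) f i.+1.
Proof.
elim: k b => [|k IHk] b; first by exists 1; rewrite !big_ord0 mulr1.
elim: b => [|b [G2 HG2]].
  by exists 1; rewrite mul1r; apply: eq_bigr.
have [G1 HG1] := IHk b.+1.
exists (G1 + 'X^(k.+1) * G2).
rewrite mulrDl -mulrA -HG2 [in LHS]big_ord_recr [in X in _ = X + _]big_ord_recr /=.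
rewrite mulrA -HG1 big_ord_recl /= [X in _ * (_ * X)](eq_bigr (fun i : 'I_k => f (b.+1 + i.+1))); last first.
  by move=> i _; rewrite /bump /= addnS add1n addSn.
rewrite mulrA [_ * \prod_(i < k) _]mulrC -mulrDr; congr (_ * _).
rewrite /f mulrBr mulr1 -exprD addrA subrK.
by congr (1 - 'X^_); rewrite addn1 !addnS !addSn addnC.
Qed.

Lemma one_subXn_neq0 j : (0 < j)%N -> f j != 0.
Proof.
move=> j0; rewrite -oppr_eq0 opprB; apply/monic_neq0.
by rewrite -[1]/(1%:P) monicXnsubC.
Qed.

(** A division-free form, which can be evaluated at a root of unity after common vanishing factors
    have been cancelled. *)
Lemma qbinom_spec (q : C) (b k : nat) : exists2 G : {poly C},
  qbinom q (b + k) k = G.[q] &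
  \prod_(i < k) f (b + i.+1) = G * \prod_(i < k) f i.+1.
Proof.
have [G HG] := gauss_divides b k; exists G => //.
rewrite /qbinom !big_add1 !big_mkord /=.
have -> : \prod_(i < k) (1 - 'X^(b + k - i.+1 + 1) : {poly C}) = \prod_(i < k) f (b + i.+1).
  rewrite (reindex_inj rev_ord_inj) /=; apply: eq_bigr => i _.
  by congr (1 - 'X^_); have := ltn_ord i; lia.
rewrite HG mulpK //; apply/prodf_neq0 => i _; exact: one_subXn_neq0.
Qed.

Lemma qbinomk1 (q : C) (k : nat) : qbinom q k.+1 1 * (1 - q) = 1 - q ^+ k.+1.
Proof.
rewrite -addn1; have [G -> HG] := qbinom_spec q k 1.
move: HG; rewrite !big_ord1 => /(congr1 (fun p => p.[q])).
by rewrite hornerM /f !hornerE.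
Qed.

Variables (q : C) (n : nat).
Hypothesis qn : n.-primitive_root q.

Lemma prim_neq1 : (1 < n)%N -> q != 1.
Proof. by move=> n1; rewrite -(expr1 q) -(prim_order_dvd qn) gtnNdvd. Qed.

Lemma qbinomk1_neq0 (k : nat) : ~~ (n %| k.+1)%N -> qbinom q k.+1 1 != 0.
Proof.
apply: contra => /eqP q0; have := qbinomk1 q k.
by rewrite q0 mul0r => /esym/eqP; rewrite subr_eq0 eq_sym -(prim_order_dvd qn).
Qed.

(** The factor 1 - X^n, which vanishes at q, is cancelled first; it leaves the sum of the X^(n j)
    for j <= l, with value l + 1. The remaining factors agree at q because q^(l n) = 1, and are
    nonzero there. *)
Lemma qbinom_mul (l : nat) : qbinom q (l.+1 * n) n = l.+1%:R.
Proof.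
have n0 := prim_order_gt0 qn.
rewrite mulSn addnC; have [G -> HG] := qbinom_spec q (l * n) n.
move: HG; rewrite -(prednK n0) !big_ord_recr /= prednK //.
have -> : f (l * n + n) = (\sum_(j < l.+1) 'X^n ^+ j) * f n.
  rewrite /f addnC -mulSn mulnC exprM mulrC.
  by rewrite -opprB subrX1 -mulNr opprB.
rewrite !mulrA => /(mulIf (one_subXn_neq0 n0)) /(congr1 (fun p => p.[q])).
rewrite !hornerM !horner_prod horner_sum.
under eq_bigr do rewrite /f !hornerE exprD mulnC exprM (prim_expr_order qn) expr1n mul1r.
rewrite [X in _ * X = _](eq_bigr (fun=> 1)); last first.
  by move=> i _; rewrite !hornerE (prim_expr_order qn) expr1n.
rewrite [X in _ = _ * X](eq_bigr (fun i : 'I_n.-1 => (1 - q ^+ i.+1))); last first.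
  by move=> i _; rewrite /f !hornerE.
rewrite sumr_const card_ord mulrC => /esym H; apply: mulIf H.
apply/prodf_neq0 => i _; rewrite subr_eq0 eq_sym -(prim_order_dvd qn) gtnNdvd //.
by rewrite -[X in (_ < X)%N](prednK n0) ltnS.
Qed.

End QBinomial.

(** * The Euler operator *)

(** Makes the [rmorph] lemmas available for the unbundled morphisms of the definitions. *)
Lemma ring_hom_bundle (A B : nzRingType) (f : A -> B) : is_ring_hom f ->
  exists g : {rmorphism A -> B}, f = g.
Proof.
case=> fD fM f1.
have f0 : f 0 = 0 by apply: (addrI (f 0)); rewrite -fD !addr0.
have fB : zmod_morphism f.
  by move=> x y; apply/eqP; rewrite -(inj_eq (addIr (f y))) -fD !subrK.
pose g : {rmorphism A -> B} := HB.pack f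
  (GRing.isZmodMorphism.Build _ _ f fB)
  (GRing.isMonoidMorphism.Build _ _ f (conj f1 fM)).
by exists g.
Qed.

Lemma rmorph_is_ring_hom (A B : nzRingType) (f : {rmorphism A -> B}) : is_ring_hom f.
Proof. by split; [exact: rmorphD | exact: rmorphM | exact: rmorph1]. Qed.

Definition cR (R : comAlgType F) (c : C) : R := in_alg R (cF c).
Arguments cR {R}.
HB.instance Definition _ (R : comAlgType F) := GRing.RMorphism.copy (@cR R)
  (in_alg R \o (@tofrac {poly C}) \o polyC).

Definition pR (R : comAlgType F) (p : {poly C}) : R := in_alg R (p%:F).
Arguments pR {R}.
HB.instance Definition _ (R : comAlgType F) := GRing.RMorphism.copy (@pR R)
  (in_alg R \o (@tofrac {poly C})).

Lemma pR_polyC (R : comAlgType F) c : pR c%:P = cR c :> R. Proof. by []. Qed.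

Lemma tF_neq0 : tF != 0. Proof. by rewrite tofrac_eq0 polyX_eq0. Qed.

Lemma cF_neq0 c : c != 0 -> cF c != 0.
Proof. by move=> c0; rewrite tofrac_eq0 polyC_eq0. Qed.

Lemma ntF_neq0 n : (0 < n)%N -> n%:R * tF ^+ n != 0.
Proof.
move=> n0; apply: mulf_neq0; last by apply: expf_neq0; exact: tF_neq0.
have -> : n%:R = cF n%:R by rewrite /cF !rmorph_nat.
by apply: cF_neq0; rewrite pnatr_eq0 -lt0n.
Qed.

Lemma prim_neq0 (n : nat) (q : C) : n.-primitive_root q -> q != 0.
Proof.
move=> qn; apply/eqP => q0; have := prim_expr_order qn.
by rewrite q0 expr0n eqn0Ngt (prim_order_gt0 qn) => /esym/eqP; rewrite oner_eq0.
Qed.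

(** Orthogonality of characters of Z/n: for distinct i, i' the ratio w is an n-th root of unity
    other than 1, so its geometric sum vanishes. *)
Lemma sum_prim_root (n : nat) (q : C) (i i' : nat) : n.-primitive_root q ->
  (i < n)%N -> (i' < n)%N ->
  \sum_(j < n) q ^+ (i * j) / q ^+ (i' * j) = if i == i' then n%:R else 0.
Proof.
move=> qn li li'; have q0 := prim_neq0 qn.
pose w := q ^+ i / q ^+ i'.
transitivity (\sum_(j < n) w ^+ j).
  by apply: eq_bigr => j _; rewrite /w exprMn -exprM exprVn -exprM.
case: eqP => [ii'|/eqP ii'].
  rewrite /w ii' divff ?expf_neq0 //.
  by under eq_bigr do rewrite expr1n; rewrite sumr_const card_ord.
have w1 : w != 1.
  apply: contra ii' => /eqP /(canRL (divfK (expf_neq0 _ q0))).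
  by rewrite mul1r => /eqP; rewrite (eq_prim_root_expr qn) !modn_small.
have /eqP := subrX1 w n.
rewrite /w exprMn -exprM mulnC exprM (prim_expr_order qn) expr1n mul1r.
rewrite exprVn -exprM mulnC exprM (prim_expr_order qn) expr1n invr1 subrr.
by rewrite eq_sym mulf_eq0 subr_eq0 (negbTE w1) /= => /eqP.
Qed.

Section Euler.
Variables (q : C) (n : nat) (R : comAlgType F) (s : {rmorphism R -> R}) (d : nat -> R -> R).
Hypotheses (n1 : (1 < n)%N) (qn : n.-primitive_root q) (H : IDq_ring q s d).
Hypothesis sn : forall x, iter n s x = x.

Let n0 : (0 < n)%N. Proof. exact: ltnW. Qed.
Let q0 : q != 0. Proof. exact: prim_neq0 qn. Qed.

Let t : R := pR 'X.

Lemma iter_rmorph_exists i : exists g : {rmorphism R -> R}, iter i s = g.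
Proof.
elim: i => [|i [g Hg]]; first by exists idfun; apply/funext.
by exists (s \o g); apply/funext => x /=; rewrite Hg.
Qed.

Lemma s_pR p : s (pR p) = pR (p \Po (q%:P * 'X)).
Proof. exact: (s_ext H). Qed.

Lemma s_cR c : s (cR c) = cR c.
Proof. by rewrite -pR_polyC s_pR comp_polyC. Qed.

Lemma s_t : s t = cR q * t.
Proof. by rewrite s_pR comp_polyX rmorphM. Qed.

Lemma d_pR k p : d k (pR p) = pR (dpoly q k p).
Proof. exact: (d_ext H). Qed.

Lemma dpolyC k c : (0 < k)%N -> dpoly q k c%:P = 0.
Proof.
move=> k0; apply/polyP => i; rewrite coef_poly coefC coef0 addn_eq0 (gtn_eqF k0) andbF mul0r.
by case: ifP.
Qed.

Lemma d_cR k c : (0 < k)%N -> d k (cR c) = 0.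
Proof. by move=> k0; rewrite -pR_polyC d_pR dpolyC // rmorph0. Qed.

Lemma d0 k : d k 0 = 0.
Proof. by apply: (addrI (d k 0)); rewrite -(d_add H) !addr0. Qed.

Lemma dB k x y : d k (x - y) = d k x - d k y.
Proof.
by apply/eqP; rewrite eq_sym subr_eq -(d_add H) subrK.
Qed.

Lemma d_compE i j x : d i (d j x) = cR (qbinom q (i + j) i) * d (i + j)%N x.
Proof. exact: (d_comp H). Qed.

Lemma d_next k x : ~~ (n %| k.+1)%N ->
  d k.+1 x = cR (qbinom q k.+1 1)^-1 * d 1 (d k x).
Proof.
move=> nk; rewrite d_compE mulrA add1n -rmorphM mulVf ?rmorph1 ?mul1r //.
apply: (qbinomk1_neq0 qn nk).
Qed.

Lemma d_nextn l x : d (l.+2 * n) x = cR (l.+2%:R)^-1 * d n (d (l.+1 * n) x).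
Proof.
rewrite d_compE mulrA -mulSn (qbinom_mul qn) -rmorphM mulVf ?rmorph1 ?mul1r //.
by rewrite pnatr_eq0.
Qed.

(* d^(k+1) is a multiple of d^(1) d^(k) if n does not divide k+1, and d^((l+2)n) is a multiple of
   d^(n) d^((l+1)n). *)
Lemma d_ind (P : nat -> R -> Prop) x :
  P 0%N x -> P n (d n x) ->
  (forall k y, ~~ (n %| k.+1)%N -> P k y -> P k.+1 (cR (qbinom q k.+1 1)^-1 * d 1 y)) ->
  (forall l y, P (l.+1 * n)%N y -> P (l.+2 * n)%N (cR (l.+2%:R)^-1 * d n y)) ->
  forall k, P k (d k x).
Proof.
move=> P0 Pn P1 PS; elim/ltn_ind => -[|k] IH; first by rewrite (d_0 H).
have [/dvdnP[[|[|l]]] |nk] := boolP (n %| k.+1)%N; first by rewrite mul0n.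
- by rewrite mul1n => ->.
- move=> E; rewrite E in IH *; rewrite d_nextn; apply/PS/IH.
  by rewrite ltn_mul2r n0 ltnS leqnn.
- by rewrite d_next //; apply: P1 => //; apply: IH.
Qed.

Lemma d1E x : d 1 x = in_alg R (cF (q - 1) * tF)^-1 * (s x - x).
Proof. exact: (d_1 H). Qed.

Lemma d1_inv x : s x = x -> d 1 x = 0.
Proof. by move=> sx; rewrite d1E sx subrr mulr0. Qed.

Lemma d_inv x j : s x = x -> (0 < j < n)%N -> d j x = 0.
Proof.
move=> sx; elim: j => // j IH /andP[_ jn].
rewrite d_next; last by rewrite gtnNdvd.
have [->|j0] := posnP j; first by rewrite (d_0 H) d1_inv ?mulr0.
by rewrite IH ?j0 1?ltnW // d0 mulr0.
Qed.

(** In the Leibniz sum only the terms 0 and n survive, by [d_inv], and the twist in the last one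
    disappears because s^n = id. *)
Lemma dn_mul_inv x y : s y = y -> d n (x * y) = d n x * y + x * d n y.
Proof.
move=> sy; rewrite (d_mul H) big_ord_recr /= subnn (d_0 H) sn; congr (_ + _).
rewrite -(prednK n0) big_ord_recl /= subn0 (d_0 H) big1 ?addr0 // => i _.
by rewrite [d _ y]d_inv ?mulr0 //= /bump /= add1n -[X in (_ < X)%N](prednK n0) ltnS.
Qed.

(* Chosen so that eulerE below acts on the q^i-eigenspace of s, i < n, as multiplication by i. *)
Definition euler_coef (j : nat) : C := n%:R^-1 * \sum_(i < n) i%:R / q ^+ (i * j).

Lemma euler_coefP i : (i < n)%N -> \sum_(j < n) euler_coef j * q ^+ (i * j) = i%:R.
Proof.
move=> li; rewrite /euler_coef.
transitivity (n%:R^-1 * \sum_(i' < n) i'%:R * \sum_(j < n) q ^+ (i * j) / q ^+ (i' * j)).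
  rewrite [in RHS](eq_bigr (fun i' : 'I_n => \sum_(j < n) i'%:R * (q ^+ (i * j) / q ^+ (i' * j)))); last first.
    by move=> i' _; rewrite mulr_sumr.
  rewrite exchange_big /= mulr_sumr; apply: eq_bigr => j _.
  rewrite -[LHS]mulrA; congr (_ * _); rewrite mulr_suml; apply: eq_bigr => i' _.
  by rewrite mulrAC mulrA.
rewrite (bigD1 (Ordinal li)) //= (sum_prim_root qn) // eqxx big1 ?addr0.
  by rewrite mulrCA mulVf ?mulr1 // pnatr_eq0 -lt0n.
move=> i' /negbTE ii'; rewrite (sum_prim_root qn) //.
by rewrite -[i == i']/(Ordinal li == i') eq_sym ii' mulr0.
Qed.

Definition eulerE (x : R) : R := \sum_(j < n) cR (euler_coef j) * iter j s x.

(** On t^i the first term acts as n times the quotient of i by n and the second as the remainder;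
    together they give the degree i, as t d/dt does. *)
Definition eulerT (x : R) : R := in_alg R (n%:R * tF ^+ n) * d n x + eulerE x.


Lemma iter_sB i x y : iter i s (x - y) = iter i s x - iter i s y.
Proof. by have [g ->] := iter_rmorph_exists i; rewrite rmorphB. Qed.

Lemma iter_sM i x y : iter i s (x * y) = iter i s x * iter i s y.
Proof. by have [g ->] := iter_rmorph_exists i; rewrite rmorphM. Qed.

Lemma iter_s_inv i x : s x = x -> iter i s x = x.
Proof. by move=> sx; elim: i => //= i ->. Qed.

Lemma iter_s_tX j i : iter j s (t ^+ i) = cR (q ^+ (i * j)) * t ^+ i.
Proof.
elim: j => [|j IH]; first by rewrite muln0 expr0 rmorph1 mul1r.
rewrite /= IH rmorphM s_cR rmorphXn s_t exprMn -rmorphXn mulrA -rmorphM.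
by rewrite -exprD mulnS addnC.
Qed.

Lemma eulerE_B x y : eulerE (x - y) = eulerE x - eulerE y.
Proof. by rewrite /eulerE -sumrB; apply: eq_bigr => j _; rewrite iter_sB mulrBr. Qed.

Lemma eulerE_mul_inv x y : s y = y -> eulerE (x * y) = eulerE x * y.
Proof.
move=> sy; rewrite /eulerE mulr_suml; apply: eq_bigr => j _.
by rewrite iter_sM (iter_s_inv _ sy) mulrA.
Qed.

Lemma eulerE_tX i : (i < n)%N -> eulerE (t ^+ i) = i%:R * t ^+ i.
Proof.
move=> li; rewrite /eulerE -[i%:R](rmorph_nat (@cR R)) -(euler_coefP li) rmorph_sum.
by rewrite mulr_suml; apply: eq_bigr => j _; rewrite iter_s_tX mulrA -rmorphM.
Qed.

Lemma eulerE_inv x : s x = x -> eulerE x = 0.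
Proof.
by move=> sx; rewrite -[x]mul1r eulerE_mul_inv // -(expr0 t) eulerE_tX // !mul0r.
Qed.

Lemma eulerT_B x y : eulerT (x - y) = eulerT x - eulerT y.
Proof. by rewrite /eulerT dB eulerE_B; ring. Qed.

Lemma eulerT0 : eulerT 0 = 0.
Proof. by have := eulerT_B 0 0; rewrite subr0 subrr. Qed.

Lemma eulerT_D x y : eulerT (x + y) = eulerT x + eulerT y.
Proof. by rewrite -{1}[y]opprK eulerT_B -[- y]sub0r eulerT_B eulerT0 sub0r opprK. Qed.

Lemma eulerT_sum (I : Type) (r : seq I) P (G : I -> R) :
  eulerT (\sum_(i <- r | P i) G i) = \sum_(i <- r | P i) eulerT (G i).
Proof. by apply: (big_morph eulerT); [exact: eulerT_D | exact: eulerT0]. Qed.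

Lemma eulerT_mul_inv x y : s y = y -> eulerT (x * y) = eulerT x * y + x * eulerT y.
Proof.
move=> sy; rewrite /eulerT dn_mul_inv // eulerE_mul_inv // [eulerE y]eulerE_inv //.
by ring.
Qed.

Lemma dpolyXn i : (i < n)%N -> dpoly q n 'X^i = 0.
Proof.
move=> li; apply/polyP => j; rewrite coef_poly coefXn coef0.
by rewrite gtn_eqF ?mul0r ?if_same // ltn_addl.
Qed.

Lemma dpolyXnn : dpoly q n 'X^n = 1.
Proof.
apply/polyP => j; rewrite coef_poly size_polyXn coefXn coef1.
have [->|j0] := posnP j.
  rewrite add0n ltnS leq0n eqxx mul1r /=.
  by have := qbinom_mul qn 0; rewrite mul1n.
have -> : (j + n == n)%N = false by lia.
by rewrite mul0r if_same.
Qed.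

(** Below n the operator d^(n) kills t^i and [eulerE] gives the degree; higher powers are reduced by
    splitting off the s-invariant factor t^n. *)
Lemma eulerT_tX i : eulerT (t ^+ i) = i%:R * t ^+ i.
Proof.
have small j : (j < n)%N -> eulerT (t ^+ j) = j%:R * t ^+ j.
  move=> lj; rewrite /eulerT eulerE_tX // -[t ^+ j]rmorphXn d_pR dpolyXn //.
  by rewrite rmorph0 mulr0 add0r.
have stn : s (t ^+ n) = t ^+ n.
  by have := iter_s_tX 1 n; rewrite /= muln1 (prim_expr_order qn) rmorph1 mul1r.
have tn : eulerT (t ^+ n) = n%:R * t ^+ n.
  have tE : t ^+ n = pR 'X^n by rewrite rmorphXn.
  rewrite /eulerT eulerE_inv // addr0 {1}tE d_pR dpolyXnn rmorph1 mulr1.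
  by rewrite rmorphM rmorph_nat rmorphXn.
elim/ltn_ind: i => i IH; have [/small //|ni] := ltnP i n.
rewrite -(subnK ni) exprD eulerT_mul_inv // tn IH; last by rewrite ltn_subrL n0 (leq_trans n0).
by rewrite natrD; ring.
Qed.

Lemma sum_cyclic (V : zmodType) (G : nat -> V) m : G m = G 0%N ->
  \sum_(j < m) G j.+1 = \sum_(j < m) G j.
Proof.
move=> Gm; apply: (addrI (G 0%N)).
transitivity (\sum_(j < m.+1) G j); first by rewrite big_ord_recl.
by rewrite big_ord_recr /= Gm addrC.
Qed.

Definition eigenproj i x : R := cR n%:R^-1 * \sum_(j < n) cR (q ^+ (i * j))^-1 * iter j s x.

Lemma s_eigenproj i x : s (eigenproj i x) = cR (q ^+ i) * eigenproj i x.
Proof.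
rewrite /eigenproj rmorphM s_cR mulrCA; congr (_ * _).
rewrite rmorph_sum mulr_sumr.
pose G j := cR (q ^+ (i * j))^-1 * iter j s x.
transitivity (\sum_(j < n) cR (q ^+ i) * G j.+1).
  apply: eq_bigr => j _; rewrite rmorphM s_cR /G mulrA -rmorphM; congr (cR _ * _).
  by rewrite mulnS exprD invfM mulrA divff ?mul1r // expf_neq0.
rewrite -!mulr_sumr (sum_cyclic (G := G)) // /G sn muln0 mulnC exprM.
by rewrite (prim_expr_order qn) expr1n.
Qed.

(** Fourier inversion on Z/n: after exchanging the sums only j = 0 contributes. *)
Lemma sum_eigenproj x : \sum_(i < n) eigenproj i x = x.
Proof.
rewrite -mulr_sumr exchange_big /= (bigD1 (Ordinal n0)) //= [X in _ + X]big1 ?addr0 => [|j j0].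
  under eq_bigr do rewrite /= muln0 expr0 invr1 rmorph1 mul1r.
  rewrite sumr_const card_ord -[x *+ n]mulr_natl mulrA -(rmorph_nat (@cR R)) -rmorphM.
  by rewrite mulVf ?rmorph1 ?mul1r // pnatr_eq0 -lt0n.
rewrite -mulr_suml -rmorph_sum.
rewrite (eq_bigr (fun i : 'I_n => q ^+ (0 * i) / q ^+ (j * i))); last first.
  by move=> i _; rewrite mul1r mulnC.
by rewrite (sum_prim_root qn) // eq_sym -[_ == _]/(j == Ordinal n0) (negbTE j0) rmorph0 mul0r.
Qed.

(** Since t is a unit with s t = q t, dividing the q^i-component of x by t^i makes it
    s-invariant. *)
Lemma eigen_decomp x : exists c : nat -> R,
  (forall i, s (c i) = c i) /\ x = \sum_(i < n) t ^+ i * c i.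
Proof.
pose ti : R := in_alg R tF^-1.
have tti : t * ti = 1 by rewrite /t /pR /ti -rmorphM mulfV ?rmorph1 ?tF_neq0.
have sti : s ti = cR q^-1 * ti.
  have : s t * s ti = 1 by rewrite -rmorphM tti rmorph1.
  rewrite s_t => E; rewrite -[LHS]mul1r -{1}tti.
  have qq : cR q^-1 * cR q = 1 :> R by rewrite -rmorphM mulVf ?rmorph1.
  transitivity (cR q^-1 * ti * (cR q * t * s ti)); last by rewrite E mulr1.
  by rewrite -[LHS]mul1r -qq; ring.
exists (fun i => ti ^+ i * eigenproj i x); split=> [i|].
  rewrite rmorphM rmorphXn sti s_eigenproj exprMn mulrACA -!rmorphXn -rmorphM.
  by rewrite exprVn mulVf ?expf_neq0 // rmorph1 mul1r.
rewrite -{1}[x]sum_eigenproj; apply: eq_bigr => i _.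
by rewrite mulrA -exprMn tti expr1n mul1r.
Qed.

(* On t^i c with s c = c, the operator acts by th (t^i c) = t^i (i c + th c), for every i. *)
Lemma eulerT_M x y : eulerT (x * y) = eulerT x * y + x * eulerT y.
Proof.
have hom i c : s c = c -> eulerT (t ^+ i * c) = t ^+ i * (i%:R * c + eulerT c).
  by move=> sc; rewrite eulerT_mul_inv // eulerT_tX; ring.
have [c [sc ->]] := eigen_decomp x; have [e [se ->]] := eigen_decomp y.
rewrite !eulerT_sum !big_distrlr /= eulerT_sum -big_split; apply: eq_bigr => i _ /=.
rewrite eulerT_sum -big_split; apply: eq_bigr => j _ /=.
rewrite [_ * c i * _](_ : _ = t ^+ (i + j) * (c i * e j)); last by rewrite exprD; ring.
rewrite !hom //; last by rewrite rmorphM sc se.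
by rewrite eulerT_mul_inv // natrD exprD; ring.
Qed.

Lemma eulerT_pR p : eulerT (pR p) = pR ('X * p^`()).
Proof.
have Tc c : eulerT (cR c) = 0.
  by rewrite /eulerT eulerE_inv ?s_cR // d_cR // mulr0 addr0.
have Tt : eulerT t = t by have := eulerT_tX 1; rewrite expr1 mul1r.
elim/poly_ind: p => [|p c IH]; first by rewrite derivC mulr0 rmorph0 eulerT0.
rewrite rmorphD rmorphM eulerT_D eulerT_M Tt IH Tc derivD derivM derivX derivC.
by rewrite !addr0 mulr1 mulrDr mulrA -/t !rmorphD !rmorphM -/t; ring.
Qed.

Lemma dnE x : d n x = in_alg R (n%:R * tF ^+ n)^-1 * (eulerT x - eulerE x).
Proof.
rewrite /eulerT addrK mulrA -rmorphM mulVf ?rmorph1 ?mul1r //.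
exact: ntF_neq0 n0.
Qed.

End Euler.

(** * Passage from the operators d^(k) to an automorphism and a derivation *)

(** The properties of a Picard-Vessiot ring in terms of [s] and [th] alone. Here z is the inverse of
    y, so [ep_gen] writes elements as Laurent polynomials in y over one common denominator. *)
Record euler_PV (q a : C) (R : comAlgType F) (s : {rmorphism R -> R})
  (th : R -> R) (y z : R) : Prop := {
  ep_B : forall x x', th (x - x') = th x - th x';
  ep_M : forall x x', th (x * x') = th x * x' + x * th x';
  ep_thpR : forall p, th (pR p) = pR ('X * p^`());
  ep_spR : forall p, s (pR p) = pR (p \Po (q%:P * 'X));
  ep_simple : forall I : R -> Prop, I 0 -> (forall x x', I x -> I x' -> I (x - x')) ->
    (forall r x, I x -> I (r * x)) -> (forall x, I x -> I (s x)) ->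
    (forall x, I x -> I (th x)) -> (forall x, I x -> x = 0) \/ (forall x, I x);
  ep_const : forall r, s r = r -> th r = 0 -> exists c, r = cR c;
  ep_sy : s y = y;
  ep_thy : th y = cR a * y;
  ep_yz : y * z = 1;
  ep_gen : forall r, exists N (p : {poly F}), r = z ^+ N * (map_poly (in_alg R) p).[y]
}.

Section FromPV.
Variables (q : C) (n : nat) (a : C) (R : comAlgType F) (s : {rmorphism R -> R})
  (d : nat -> R -> R) (y : R).
Hypotheses (n1 : (1 < n)%N) (qn : n.-primitive_root q) (H : PV_ring q n a s d y).

Let H0 : IDq_ring q s d := pv_IDq H.

Lemma pv_sy : s y = y.
Proof.
have := pv_sol1 H; rewrite (d1E H0) => /(congr1 (fun x => in_alg R (cF (q - 1) * tF) * x)).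
rewrite mulr0 mulrA -rmorphM mulfV ?rmorph1 ?mul1r; last first.
  apply: mulf_neq0 tF_neq0; apply: cF_neq0; rewrite subr_eq0; exact: prim_neq1 qn n1.
by move=> /eqP; rewrite subr_eq0 => /eqP.
Qed.

Lemma iter_s_pR i (p : {poly C}) : iter i s (pR p) = pR (p \Po ((q ^+ i)%:P * 'X)).
Proof.
elim: i => [|i IH] /=; first by rewrite expr0 mul1r comp_polyXr.
rewrite IH (s_pR H0) -comp_polyA; congr (pR (_ \Po _)).
by rewrite comp_polyM comp_polyC comp_polyX exprSr rmorphM mulrA.
Qed.

(** The n-th iterate fixes polynomials because q^n = 1, hence fractions; it fixes y and z as well,
    and these generate R. *)
Lemma pv_sn x : iter n s x = x.
Proof.
have [z [yz gen]] := pv_gen H.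
have [g Hg] := iter_rmorph_exists s n.
have gy : g y = y by rewrite -Hg iter_s_inv // pv_sy.
have gz : g z = z.
  have := congr1 g yz; rewrite rmorphM rmorph1 gy => E.
  by rewrite -[LHS]mul1r -yz mulrAC E mul1r.
have gp p : g (pR p) = pR p.
  by rewrite -Hg iter_s_pR (prim_expr_order qn) mul1r comp_polyXr.
have gF f : g (in_alg R f) = in_alg R f.
  rewrite (fraction_reprE f) rmorphM -/(pR _).
  set r := \d_(repr f); pose v : R := in_alg R (r%:F)^-1.
  have rv : pR r * v = 1.
    by rewrite /pR -rmorphM mulfV ?rmorph1 // tofrac_eq0 den_neq0.
  rewrite rmorphM gp; congr (_ * _); rewrite -/v.
  have := congr1 g rv; rewrite rmorphM gp rmorph1 => E.
  by rewrite -[LHS]mul1r -rv mulrAC E mul1r.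
have [N [f ->]] := gen x.
rewrite Hg rmorph_sum; apply: eq_bigr => i _; rewrite rmorph_sum; apply: eq_bigr => j _.
by rewrite !rmorphM !rmorphXn gy gz gF.
Qed.

Let th := eulerT q n s d.

Lemma euler_PV_exists : exists z, euler_PV q a s th y z.
Proof.
have [z [yz gen]] := pv_gen H; exists z.
have n0 : (0 < n)%N := ltnW n1.
have dn1 := dnE q s d n1.
split => //.
- exact: (eulerT_B n H0).
- exact: (eulerT_M n1 qn H0 pv_sn).
- exact: (eulerT_pR n1 qn H0 pv_sn).
- exact: (s_pR H0).
(* An ideal stable under [s] and [th] is stable under d^(1) and d^(n), hence under all d^(k) by
   [d_ind]. *)
- move=> I I0 IB IM Is It.
  have ID x x' : I x -> I x' -> I (x + x').
    by move=> Ix Ix'; rewrite -[x']opprK; apply: (IB) => //; rewrite -sub0r; apply: IB.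
  have I1 x : I x -> I (d 1 x).
    by move=> Ix; rewrite (d1E H0); apply/IM/IB => //; apply: Is.
  have In x : I x -> I (d n x).
    move=> Ix; rewrite dn1; apply/IM/IB; first exact: It.
    rewrite /eulerE; apply: (big_ind I I0 ID) => j _; apply: IM.
    by elim: (nat_of_ord j) => //= k; apply: Is.
  apply: (pv_simple H) => // k x Ix.
  apply: (d_ind n1 qn H0 (P := fun k => I)) => //.
  + exact: In.
  + by move=> *; apply/IM/I1.
  + by move=> *; apply/IM/In.
- move=> r sr tr; apply: (pv_const H) => k k0.
  have dr1 : d 1 r = 0 by exact: (d1_inv H0).
  have drn : d n r = 0 by rewrite dn1 (eulerE_inv n1 qn H0) // -/th tr subrr mulr0.
  (* The recursion of [d_ind] starts with r at index 0 and yields 0 from then on. *)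
  have : (k = 0%N /\ d k r = r) \/ d k r = 0.
    apply: (d_ind n1 qn H0 (P := fun k x => (k = 0%N /\ x = r) \/ x = 0)).
    + by left.
    + by right.
    + by move=> j x _ [[_ ->]|->]; right; rewrite ?dr1 ?(d0 H0) mulr0.
    + by move=> j x [[_ ->]|->]; right; rewrite ?drn ?(d0 H0) mulr0.
  by case=> // -[k0']; rewrite k0' in k0.
- exact: pv_sy.
- have := pv_soln H; rewrite dn1 (eulerE_inv n1 qn H0) ?pv_sy // subr0 -/th => E.
  have ntF0 := ntF_neq0 n0.
  move/(congr1 (fun x => in_alg R (n%:R * tF ^+ n) * x)): E.
  rewrite !mulrA -!rmorphM mulfV // rmorph1 mul1r => ->.
  by rewrite mulrCA mulfV // mulr1.
- move=> r; have [N [f ->]] := gen r.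
  (* As j < N, writing z^j = z^N y^(N - j) gives all terms the same denominator. *)
  exists N, (\sum_(i < N) \sum_(j < N) f i j *: 'X^(i + (N - j))).
  rewrite rmorph_sum horner_sum mulr_sumr; apply: eq_bigr => i _.
  rewrite rmorph_sum horner_sum mulr_sumr; apply: eq_bigr => j _.
rewrite /= map_polyZ map_polyXn hornerZ hornerXn.
  have zN : z ^+ N = z ^+ j * z ^+ (N - j) by rewrite -exprD subnKC // ltnW.
  have yzN : y ^+ (N - j) * z ^+ (N - j) = 1 by rewrite -exprMn yz expr1n.
  rewrite zN exprD; transitivity (in_alg R (f i j) * y ^+ i * z ^+ j * (y ^+ (N - j) * z ^+ (N - j))); last by ring.
  by rewrite yzN mulr1.
Qed.
End FromPV.

(** * Powers of the solution *)

Lemma comp_poly_scale (c : C) (p : {poly C}) i : (p \Po (c%:P * 'X))`_i = c ^+ i * p`_i.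
Proof.
have -> : p \Po (c%:P * 'X) = \poly_(i < size p) (p`_i * c ^+ i).
  rewrite comp_polyE poly_def; apply: eq_bigr => j _.
  by rewrite exprMn -polyC_exp mul_polyC scalerA.
rewrite coef_poly [RHS]mulrC; case: ltnP => // /(nth_default 0) ->.
by rewrite mul0r.
Qed.

Lemma coef_XderivE (p : {poly C}) i : ('X * p^`())`_i = i%:R * p`_i.
Proof.
rewrite coefXM coef_deriv; case: i => [|i] /=; first by rewrite mul0r.
by rewrite mulr_natl.
Qed.

(** Only upper bounds on the sizes are assumed, so it also covers X p', whose degree may drop. *)
Lemma coefM_top (p r : {poly C}) k l : (size p <= k.+1)%N -> (size r <= l.+1)%N ->
  (p * r)`_(k + l) = p`_k * r`_l.
Proof.
move=> pk rl; rewrite coefM.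
have lk : (k < (k + l).+1)%N by rewrite ltnS leq_addr.
rewrite (bigD1 (Ordinal lk)) //= addKn big1 ?addr0 // => i ik.
have [ki|ki] := ltnP k i; first by rewrite (nth_default 0) ?mul0r // (leq_trans pk).
have {}ki : (i < k)%N by rewrite ltn_neqAle ki andbT.
by rewrite (nth_default 0 (s := r)) ?mulr0 // (leq_trans rl) //; lia.
Qed.

Lemma size_scale_le (c : C) (p : {poly C}) : (size (p \Po (c%:P * 'X)) <= size p)%N.
Proof.
by apply/leq_sizeP => i pi; rewrite comp_poly_scale (nth_default 0) ?mulr0.
Qed.

Lemma size_Xderiv_le (p : {poly C}) : (size ('X * p^`())%R <= size p)%N.
Proof.
by apply/leq_sizeP => i pi; rewrite coef_XderivE (nth_default 0) ?mulr0.
Qed.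

Lemma in_alg_inj (R : comAlgType F) : injective (in_alg R).
Proof. exact: fmorph_inj. Qed.

Lemma pR_inj (R : comAlgType F) : injective (@pR R).
Proof.
by move=> p r /in_alg_inj /eqP; rewrite tofrac_eq => /eqP.
Qed.

Definition inF (R : comAlgType F) (x : R) := exists f, x = in_alg R f.

(** The operators [s] and [th] are given on polynomials only; an equation x r = p carries their
    values over to fractions. *)
Lemma inF_frac (R : comAlgType F) (x : R) : inF x <->
  exists p r : {poly C}, r != 0 /\ x * pR r = pR p.
Proof.
split=> [[f ->]|[p [r [r0 xr]]]].
  exists (\n_(repr f)), (\d_(repr f)); split; first exact: den_neq0.
  rewrite {1}(fraction_reprE f) /pR -rmorphM divfK // tofrac_eq0; exact: den_neq0.
have r0' : r%:F != 0 :> F by rewrite tofrac_eq0.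
have xr' : x * in_alg R r%:F = in_alg R p%:F := xr.
exists (p%:F / r%:F); transitivity (in_alg R p%:F * in_alg R (r%:F)^-1); last by rewrite -rmorphM.
by rewrite -xr' -mulrA -rmorphM mulfV // rmorph1 mulr1.
Qed.

Section Structure.
Variables (q a : C) (n : nat) (R : comAlgType F) (s : {rmorphism R -> R}) (th : R -> R).
Variables (y z : R).
Hypotheses (n1 : (1 < n)%N) (qn : n.-primitive_root q) (E : euler_PV q a s th y z).

Lemma inF_B (x x' : R) : inF x -> inF x' -> inF (x - x').
Proof. by move=> [f ->] [g ->]; exists (f - g); rewrite rmorphB. Qed.

Lemma inF_M (x x' : R) : inF x -> inF x' -> inF (x * x').
Proof. by move=> [f ->] [g ->]; exists (f * g); rewrite rmorphM. Qed.

Lemma inF_cR c : inF (cR c : R).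
Proof. by exists (cF c). Qed.

Lemma inF_s (x : R) : inF x -> inF (s x).
Proof.
move=> /inF_frac[p [r [r0 xr]]]; apply/inF_frac.
exists (p \Po (q%:P * 'X)), (r \Po (q%:P * 'X)); split; last first.
  by rewrite -!(ep_spR E) -xr rmorphM.
apply: contra r0 => /eqP r0; apply/eqP/polyP => i.
have /eqP := comp_poly_scale q r i; rewrite r0 coef0 eq_sym mulf_eq0.
by rewrite expf_eq0 (negbTE (prim_neq0 qn)) andbF /= => /eqP.
Qed.

Lemma inF_th (x : R) : inF x -> inF (th x).
Proof.
move=> xF; have /inF_frac[p [r [r0 xr]]] := xF.
have r0' : r%:F != 0 :> F by rewrite tofrac_eq0.
have /(congr1 th) := xr; rewrite (ep_M E) !(ep_thpR E) => Ex.
have -> : th x = (pR ('X * p^`()) - x * pR ('X * r^`())) * in_alg R (r%:F)^-1.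
  by rewrite -Ex addrK -mulrA /pR -rmorphM mulfV // rmorph1 mulr1.
apply: inF_M; last by exists (r%:F)^-1.
apply: inF_B; first by exists ('X * p^`())%:F.
by apply: inF_M => //; exists ('X * r^`())%:F.
Qed.

Lemma inF_inv (x : R) : inF x -> x != 0 -> exists x', inF x' /\ x * x' = 1.
Proof.
move=> [f ->] f0; exists (in_alg R f^-1); split; first by exists f^-1.
rewrite -rmorphM mulfV ?rmorph1 //; apply: contra f0 => /eqP ->.
by rewrite rmorph0.
Qed.

Lemma th0 : th 0 = 0.
Proof. by have := ep_B E 0 0; rewrite subr0 subrr. Qed.

Lemma thD x x' : th (x + x') = th x + th x'.
Proof. by rewrite -{1}[x']opprK (ep_B E) -[- x']sub0r (ep_B E) th0 sub0r opprK. Qed.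

Lemma th_sum (I : Type) (r : seq I) P (G : I -> R) :
  th (\sum_(i <- r | P i) G i) = \sum_(i <- r | P i) th (G i).
Proof. by apply: (big_morph th); [exact: thD | exact: th0]. Qed.

Lemma th_cR c : th (cR c) = 0.
Proof. by rewrite -pR_polyC (ep_thpR E) derivC mulr0 rmorph0. Qed.

Lemma s_z : s z = z.
Proof.
have := congr1 s (ep_yz E); rewrite rmorphM rmorph1 (ep_sy E) => Es.
by rewrite -[LHS]mul1r -(ep_yz E) mulrAC Es mul1r.
Qed.

Lemma th_X (x : R) (c : C) i : th x = cR c * x -> th (x ^+ i) = cR (c * i%:R) * x ^+ i.
Proof.
move=> thx; elim: i => [|i IH]; first by rewrite expr0 mulr0 rmorph0 mul0r -(rmorph1 (@cR R)) th_cR.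
by rewrite exprS (ep_M E) thx IH -natr1 mulrDr mulr1 rmorphD; ring.
Qed.

Lemma thV (x x' : R) (c : C) : x * x' = 1 -> th x = cR c * x -> th x' = cR (- c) * x'.
Proof.
move=> xx thx; have := congr1 th xx.
rewrite (ep_M E) -(rmorph1 (@cR R)) th_cR thx => /eqP.
rewrite addrC addr_eq0 => /eqP Ex.
rewrite -[LHS]mul1r -xx mulrAC Ex rmorphN.
by transitivity (- cR c * x' * (x * x')); [ring | rewrite xx mulr1].
Qed.

Lemma th_z : th z = cR (- a) * z.
Proof. exact: thV (ep_yz E) (ep_thy E). Qed.

Lemma yz_expr i : y ^+ i * z ^+ i = 1.
Proof. by rewrite -exprMn (ep_yz E) expr1n. Qed.

(* Normalize the leading coefficient to 1; applying s - 1 and th - k a gives shorter relations, so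
   each g i y^i / y^k is a constant, and a nonzero one would put y^(k-i) in F. *)
Lemma indep k : (forall j, (0 < j < k)%N -> ~ inF (y ^+ j)) ->
  forall g : nat -> R, (forall i, inF (g i)) -> \sum_(i < k) g i * y ^+ i = 0 ->
  forall i, (i < k)%N -> g i = 0.
Proof.
elim: k => [//|k IH] Hk g gF.
have {}IH : forall g : nat -> R, (forall i, inF (g i)) -> \sum_(i < k) g i * y ^+ i = 0 ->
    forall i, (i < k)%N -> g i = 0.
  by apply: IH => j /andP[j0 jk]; apply: Hk; rewrite j0 ltnW.
rewrite big_ord_recr /= => E0.
suff gk : g k = 0.
  move: E0; rewrite gk mul0r addr0 => /(IH _ gF) E0 i.
  by rewrite ltnS leq_eqVlt => /orP[/eqP ->|/E0].
apply: contrapT => /eqP gk0.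
have [gk' [gkF gkk]] := inF_inv (gF k) gk0.
pose h i := gk' * g i.
have hF i : inF (h i) by apply: inF_M.
have hk : y ^+ k = - \sum_(i < k) h i * y ^+ i.
  apply/eqP; rewrite -addr_eq0 addrC; apply/eqP.
  transitivity (gk' * (\sum_(i < k) g i * y ^+ i + g k * y ^+ k)); last by rewrite E0 mulr0.
  rewrite mulrDr mulrA [gk' * g k]mulrC gkk mul1r mulr_sumr; congr (_ + _).
  by apply: eq_bigr => i _; rewrite mulrA.
move: h hF hk => h hF hk.
have sh i : (i < k)%N -> s (h i) = h i.
  move=> ik; apply/eqP; rewrite -subr_eq0; apply/eqP; move: i ik.
  apply: (IH (fun i => s (h i) - h i)) => [i|].
    by apply: inF_B => //; apply: inF_s.
  have /(congr1 s) := hk; rewrite rmorphXn (ep_sy E) hk rmorphN rmorph_sum => /oppr_inj Es.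
  under eq_bigr do rewrite mulrBl.
  rewrite sumrB Es; apply/eqP; rewrite subr_eq0; apply/eqP/eq_bigr => i _.
  by rewrite rmorphM rmorphXn (ep_sy E).
have thh i : (i < k)%N -> th (h i) = cR (a * (k%:R - i%:R)) * h i.
  move=> ik; apply/eqP; rewrite -subr_eq0; apply/eqP; move: i ik.
  apply: (IH (fun i => th (h i) - cR (a * (k%:R - i%:R)) * h i)) => [i|].
    apply: inF_B; first exact: inF_th.
    by apply: inF_M => //; apply: inF_cR.
  have /(congr1 th) := hk; rewrite (th_X _ (ep_thy E)) -[- \sum_(i < k) _]sub0r (ep_B E) th0 sub0r.
  rewrite hk th_sum mulrN => /oppr_inj /eqP; rewrite -subr_eq0 mulr_sumr -sumrB => /eqP Et.
  rewrite -[RHS]oppr0 -[in RHS]Et -sumrN; apply: eq_bigr => i _.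
  by rewrite (ep_M E) (th_X _ (ep_thy E)) !rmorphM rmorphB; ring.
(* The rates a (k - i), a i and - a k of the three factors under [th] add up to 0. *)
have hc i : (i < k)%N -> exists c, h i * y ^+ i * z ^+ k = cR c.
  move=> ik; apply: (ep_const E); first by rewrite !rmorphM !rmorphXn (ep_sy E) s_z sh.
  by rewrite !(ep_M E) (th_X _ (ep_thy E)) (th_X _ th_z) thh // !rmorphM rmorphB rmorphN; ring.
(* If all h i vanished, then y^k would be 0, although y is a unit. *)
have [[i [ik hi0]]|nh] := pselect (exists i, (i < k)%N /\ h i != 0); last first.
  have : y ^+ k * z ^+ k = 0.
    rewrite hk big1 ?oppr0 ?mul0r // => i _.
    have [->|hi] := eqVneq (h i) 0; first by rewrite mul0r.
    by case: nh; exists i.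
  by rewrite yz_expr => /eqP; rewrite oner_eq0.
have [c hc'] := hc i ik.
have hiE : h i = cR c * y ^+ (k - i).
  have ki : y ^+ k = y ^+ (k - i) * y ^+ i by rewrite -exprD subnK // ltnW.
  rewrite -hc'; transitivity (h i * (y ^+ k * z ^+ k)); first by rewrite yz_expr mulr1.
  by rewrite ki; ring.
have c0 : c != 0 by apply: contra hi0 => /eqP c0; rewrite hiE c0 rmorph0 mul0r.
apply: (Hk (k - i)%N); first by rewrite subn_gt0 ik ltnS leq_subr.
have -> : y ^+ (k - i) = cR c^-1 * h i.
  by rewrite hiE mulrA -rmorphM mulVf // rmorph1 mul1r.
by apply: inF_M => //; apply: inF_cR.
Qed.

(* For y^j = p / r the integers k and l are the degrees of p and r. *)
Lemma inF_powy_exponent j : inF (y ^+ j) ->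
  exists k l : nat, a * j%:R = k%:R - l%:R /\ q ^+ k = q ^+ l.
Proof.
move=> /inF_frac[p [r [r0 Epr]]].
have p0 : p != 0.
  apply: contra r0 => /eqP p0; move: Epr; rewrite p0 rmorph0 => /(congr1 ( *%R (z ^+ j))).
  by rewrite mulr0 mulrA [z ^+ j * _]mulrC yz_expr mul1r -(rmorph0 (@pR R)) => /pR_inj ->.
pose k := (size p).-1; pose l := (size r).-1.
have sp : (size p <= k.+1)%N by rewrite leqSpred.
have sr : (size r <= l.+1)%N by rewrite leqSpred.
have pk : p`_k != 0 by rewrite -/(lead_coef p) lead_coef_eq0.
have rl : r`_l != 0 by rewrite -/(lead_coef r) lead_coef_eq0.
exists k, l; split.
  (* This is [th] applied to y^j r = p, multiplied by r. In degree k + l it reads a j + l = k, up to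
     the leading coefficients. *)
  have : (a * j%:R)%:P * (p * r) + p * ('X * r^`()) = ('X * p^`()) * r.
    apply: (@pR_inj R); have := congr1 th Epr.
    rewrite (ep_M E) (th_X _ (ep_thy E)) !(ep_thpR E) !rmorphD => Et.
    transitivity (pR ('X * p^`()) * pR r : R); last by rewrite -rmorphM.
    rewrite -Et !rmorphM /= -Epr pR_polyC; ring.
  move=> /(congr1 (fun p : {poly C} => p`_(k + l))).
  have szD (p' : {poly C}) m : (size p' <= m)%N -> (size ('X * p'^`())%R <= m)%N.
    exact/leq_trans/size_Xderiv_le.
  rewrite coefD coefCM !coefM_top ?szD // !coef_XderivE => Ec.
  apply: (mulIf (mulf_neq0 pk rl)).
  transitivity (k%:R * p`_k * r`_l - p`_k * (l%:R * r`_l)); last by ring.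
  by rewrite -Ec addrK.
(* The same with [s]: degree k + l gives q^l = q^k. *)
have : p * (r \Po (q%:P * 'X)) = (p \Po (q%:P * 'X)) * r.
  apply: (@pR_inj R); have := congr1 s Epr.
  rewrite rmorphM rmorphXn (ep_sy E) !(ep_spR E) => Es.
  transitivity (pR (p \Po (q%:P * 'X)) * pR r : R); last by rewrite -rmorphM.
  rewrite -Es rmorphM /= -Epr; ring.
move=> /(congr1 (fun p : {poly C} => p`_(k + l))).
have szS (p' : {poly C}) m : (size p' <= m)%N -> (size (p' \Po (q%:P * 'X)) <= m)%N.
  exact/leq_trans/size_scale_le.
rewrite !coefM_top ?szS // !comp_poly_scale => Ec.
apply: (mulIf (mulf_neq0 pk rl)); rewrite mulrA -Ec; ring.
Qed.

Lemma powy_notin_F_irrational : ~ (exists r : rat, a = ratr r) ->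
  forall j, (0 < j)%N -> ~ inF (y ^+ j).
Proof.
move=> na j j0 /inF_powy_exponent[k [l [Ea _]]]; apply: na.
have j0' : j%:R != 0 :> C by rewrite pnatr_eq0 -lt0n.
exists ((k%:R - l%:R) / j%:R); rewrite rmorphM fmorphV rmorphB !rmorph_nat -Ea.
by rewrite mulfK.
Qed.

Lemma horner_indep k (p : {poly F}) : (forall j, (0 < j < k)%N -> ~ inF (y ^+ j)) ->
  (size p <= k)%N -> (map_poly (in_alg R) p).[y] = 0 -> p = 0.
Proof.
move=> Hk pk; rewrite (horner_coef_wide _ (n := k)); last by rewrite size_map_poly.
move=> E0; apply/polyP => i; rewrite coef0; have [ik|ki] := ltnP i k; last first.
  by rewrite nth_default // (leq_trans pk).
apply: (@in_alg_inj R); rewrite rmorph0.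
apply: (indep Hk (g := fun i => in_alg R p`_i)) => // [j|]; first by exists p`_j.
by rewrite -[RHS]E0; apply: eq_bigr => j _; rewrite coef_map.
Qed.

Lemma horner_eq0_irrational : ~ (exists r : rat, a = ratr r) ->
  forall p : {poly F}, (map_poly (in_alg R) p).[y] = 0 -> p = 0.
Proof.
move=> /powy_notin_F_irrational Hj p; apply: (@horner_indep (size p)) => // j /andP[j0 _].
exact: Hj.
Qed.
End Structure.

(** * Relations satisfied by y, and morphisms out of R *)

(** A pair (N, p) encodes the Laurent polynomial p / X^N; this is subtraction of codes, for any
    target ring, so that it serves both the source and the target of [PV_hom]. *)
Lemma laurent_sub (B : comNzRingType) (v : {rmorphism F -> B}) (x x' : B)
    N M (p r : {poly F}) : x * x' = 1 ->
  x' ^+ (N + M) * (map_poly v (p * 'X^M - r * 'X^N)).[x] =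
  x' ^+ N * (map_poly v p).[x] - x' ^+ M * (map_poly v r).[x].
Proof.
move=> xx; have xX i : x ^+ i * x' ^+ i = 1 by rewrite -exprMn xx expr1n.
rewrite rmorphB !rmorphM /= !map_polyXn hornerD hornerN !hornerM !hornerXn exprD.
rewrite -[in RHS](mulr1 (x' ^+ N)) -[in RHS](mulr1 (x' ^+ M)) -{1}(xX M) -{1}(xX N).
by ring.
Qed.

Lemma laurent_mul (B : comNzRingType) (v : {rmorphism F -> B}) (x x' : B)
    N M (p r : {poly F}) :
  x' ^+ (N + M) * (map_poly v (p * r)).[x] =
  (x' ^+ N * (map_poly v p).[x]) * (x' ^+ M * (map_poly v r).[x]).
Proof. by rewrite rmorphM hornerM exprD /=; ring. Qed.

Section Rational.
Variables (q a : C) (n : nat) (R : comAlgType F) (s : {rmorphism R -> R}) (th : R -> R).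
Variables (y z : R).
Hypotheses (n1 : (1 < n)%N) (qn : n.-primitive_root q) (E : euler_PV q a s th y z).

(** The element is t^(n e), with its inverse; the factor n in the exponent makes it s-invariant. *)
Lemma tX_int (e : int) : exists x x' : R,
  [/\ inF x', x * x' = 1, s x = x & th x = cR (n%:R * e%:~R) * x].
Proof.
have pos k : s (pR ('X^(n * k))) = pR ('X^(n * k)) /\
    th (pR ('X^(n * k))) = cR (n%:R * k%:R) * pR ('X^(n * k)).
  split.
    rewrite (ep_spR E) comp_Xn_poly exprMn -rmorphXn.
    by rewrite exprM (prim_expr_order qn) expr1n mul1r.
  rewrite -natrM rmorphXn; have := @th_X q a R s th y z E (pR 'X) 1 (n * k).
  rewrite mul1r => -> //; rewrite (ep_thpR E) derivX mulr1 rmorph1 mul1r //.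
have inv k : pR ('X^(n * k)) * in_alg R (tF ^+ (n * k))^-1 = 1 :> R.
  rewrite /pR -rmorphM rmorphXn mulfV ?rmorph1 //; apply: expf_neq0; exact: tF_neq0.
case: e => k.
  have [sx thx] := pos k; exists (pR ('X^(n * k))), (in_alg R (tF ^+ (n * k))^-1).
  by split=> //; exists (tF ^+ (n * k))^-1.
(* Here e is -(k + 1), so the two powers exchange roles. *)
have [sx thx] := pos k.+1.
exists (in_alg R (tF ^+ (n * k.+1))^-1), (pR ('X^(n * k.+1))); split=> //.
- by exists ('X^(n * k.+1))%:F.
- by rewrite mulrC.
- have := congr1 s (inv k.+1); rewrite rmorphM rmorph1 sx => Es.
  by rewrite -[LHS]mul1r -(inv k.+1) mulrAC Es mul1r.
- by rewrite (thV E (inv k.+1) thx) NegzE mulrNz mulrN.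
Qed.

(** Take m to be the denominator of a / n. Then y^m times t^(- n numq (a / n)) is killed by [th] and
    fixed by [s], hence constant. Conversely, if y^j lies in F, then a j is a multiple of n, so (a /
    n) j is an integer and m divides j. *)
Lemma powy_in_F_rational (r : rat) : a = ratr r -> exists m b,
  [/\ (0 < m)%N, b != 0, y ^+ m = in_alg R b & forall j, (0 < j < m)%N -> ~ inF (y ^+ j)].
Proof.
move=> ar; pose rho := r / n%:R.
have n0 : n%:R != 0 :> C by rewrite pnatr_eq0 -lt0n ltnW.
have n0' : n%:R != 0 :> rat by rewrite pnatr_eq0 -lt0n ltnW.
pose m := `|denq rho|%N.
have mE : denq rho = m%:Z by rewrite /m gez0_abs // denq_ge0.
have m0 : (0 < m)%N by rewrite absz_gt0 denq_neq0.
have m0' : m%:R != 0 :> rat by rewrite pnatr_eq0 -lt0n.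
have rhoE : rho * m%:R = (numq rho)%:~R.
  rewrite -[rho in LHS]divq_num_den mE -[m%:Z%:~R]/(m%:R) divfK //.
have amE : a * m%:R = n%:R * (numq rho)%:~R.
  rewrite ar -(rmorph_nat (@ratr C) m) -rmorphM -(rmorph_int (@ratr C)) -rhoE.
  by rewrite -(rmorph_nat (@ratr C) n) -rmorphM /rho; congr ratr; field.
have [x [x' [x'F xx sx thx]]] := tX_int (- numq rho).
have [c hc] : exists c, y ^+ m * x = cR c.
  apply: (ep_const E); first by rewrite rmorphM rmorphXn (ep_sy E) sx.
  rewrite (ep_M E) (th_X E _ (ep_thy E)) thx amE rmorphN mulrN rmorphN.
  by ring.
have [b ymE] : inF (y ^+ m).
  rewrite -[y ^+ m]mulr1 -xx mulrA hc; apply: inF_M => //; exact: inF_cR.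
exists m, b; split=> //.
  apply/eqP => b0; have := yz_expr E m; rewrite ymE b0 rmorph0 mul0r => /esym/eqP.
  by rewrite oner_eq0.
move=> j /andP[j0 jm] /(inF_powy_exponent E)[k [l [Ea qkl]]].
have [e eE] : exists e : int, k%:R - l%:R = n%:R * e%:~R :> C.
  have /eqP := qkl; rewrite (eq_prim_root_expr qn).
  have [kl|/ltnW lk] := leqP l k.
    rewrite (eqn_mod_dvd _ kl) => /dvdnP[e E'].
    by exists e%:Z; rewrite -natrB // E' natrM mulrC.
  rewrite eq_sym (eqn_mod_dvd _ lk) => /dvdnP[e E'].
  by exists (- e%:Z); rewrite -opprB -natrB // E' natrM mulrC mulrNz mulrN.
have rje : rho * j%:R = e%:~R.
  apply: (fmorph_inj (@ratr C)); apply: (mulfI n0).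
  rewrite rmorph_int -eE -Ea ar /rho !rmorphM fmorphV !rmorph_nat.
  by field.
have numE : numq rho * j%:Z = e * m%:Z.
  apply: (@intr_inj rat); rewrite !rmorphM /= -rhoE -rje.
  by rewrite -[j%:Z%:~R]/(j%:R) -[m%:Z%:~R]/(m%:R); ring.
have : (m %| j)%N.
  rewrite -(@Gauss_dvdr _ `|numq rho|%N); last by rewrite coprime_sym; exact: coprime_num_den.
  by have /(congr1 absz) := numE; rewrite !abszM !absz_nat => ->; rewrite dvdn_mull.
by move=> /dvdn_leq -/(_ j0); rewrite leqNgt jm.
Qed.

(** The remainder modulo X^m - b has degree below m, so independence of the lower powers of y forces
    it to be 0. *)
Lemma horner_eq0_rational (r : rat) : a = ratr r -> exists m b,
  [/\ (0 < m)%N, b != 0, y ^+ m = in_alg R b &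
  forall p : {poly F}, (map_poly (in_alg R) p).[y] = 0 -> exists p', p = p' * ('X^m - b%:P)].
Proof.
move=> /powy_in_F_rational[m [b [m0 b0 yb Hm]]]; exists m, b; split=> // p py.
exists (p %/ ('X^m - b%:P)); rewrite {1}(divp_eq p ('X^m - b%:P)).
rewrite [X in _ + X](_ : _ = 0) ?addr0 //.
apply: (horner_indep qn E Hm).
  by rewrite -ltnS -(size_XnsubC b m0) ltn_modp monic_neq0 ?monicXnsubC.
rewrite -[RHS]py [in RHS](divp_eq p ('X^m - b%:P)) rmorphD hornerD rmorphM hornerM /=.
rewrite [X in _ = _ * X + _](_ : _ = 0) ?mulr0 ?add0r //.
by rewrite rmorphB /= map_polyXn map_polyC hornerD hornerN hornerXn hornerC yb subrr.
Qed.

Section Ext.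
Variables (S : comNzRingType) (u : {rmorphism F -> S}) (eta eta' : S).
Hypothesis etaV : eta * eta' = 1.
Hypothesis rel : forall p : {poly F}, (map_poly (in_alg R) p).[y] = 0 -> (map_poly u p).[eta] = 0.

(** R is the Laurent polynomial ring over F modulo the relations of y, so a unit satisfying these
    relations defines a morphism. The map is computed on chosen codes (N, p), and [wd] makes it
    independent of the choice. *)
Lemma PV_hom : exists h : {rmorphism R -> S},
  [/\ forall f, h (in_alg R f) = u f, h y = eta & h z = eta'].
Proof.
pose eR N (p : {poly F}) := z ^+ N * (map_poly (in_alg R) p).[y].
pose eS N (p : {poly F}) := eta' ^+ N * (map_poly u p).[eta].
have wd N M (p r : {poly F}) : eR N p = eR M r -> eS N p = eS M r.
  move=> /eqP; rewrite -subr_eq0 -(laurent_sub _ _ _ _ _ (ep_yz E)) => /eqP Epr.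
  apply/eqP; rewrite -subr_eq0 -(laurent_sub _ _ _ _ _ etaV); apply/eqP.
  rewrite rel ?mulr0 // -[LHS]mul1r -(yz_expr E (N + M)).
  by rewrite -mulrA Epr mulr0.
pose Q x (Np : nat * {poly F}) := x = eR Np.1 Np.2.
have exQ x : exists Np, Q x Np.
  by have [N [p ->]] := ep_gen E x; exists (N, p).
have [G HG] := choice exQ.
pose h x := eS (G x).1 (G x).2.
have hE x N p : x = eR N p -> h x = eS N p.
  by move=> xE; apply: wd; rewrite -xE; exact/esym/HG.
have hF f : h (in_alg R f) = u f.
  rewrite (hE _ 0%N f%:P); first by rewrite /eS mul1r map_polyC hornerC.
  by rewrite /eR mul1r map_polyC hornerC.
have hB : zmod_morphism h.
  move=> x x'; rewrite -(laurent_sub _ _ _ _ _ etaV).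
  by apply: hE; rewrite /eR (laurent_sub _ _ _ _ _ (ep_yz E)) -!/(eR _ _) -!HG.
have hM : {morph h : x x' / x * x'}.
  move=> x x'; rewrite -laurent_mul.
  by apply: hE; rewrite /eR laurent_mul -!/(eR _ _) -!HG.
have h1 : h 1 = 1 by rewrite -(rmorph1 (in_alg R)) hF rmorph1.
pose hr : {rmorphism R -> S} := HB.pack h
  (GRing.isZmodMorphism.Build _ _ h hB)
  (GRing.isMonoidMorphism.Build _ _ h (conj h1 hM)).
exists hr; split=> //=.
  rewrite (hE y 0%N 'X) ?/eS ?/eR mul1r map_polyX hornerX //.
rewrite (hE z 1%N 1) ?/eS ?/eR rmorph1 hornerC mulr1 expr1 //.
Qed.
End Ext.
End Rational.

(** * Tensor products *)

Section Tensor.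
Variables (R : comAlgType F) (A : comAlgType C) (T : tensor R A).

Let is_zmod_morphism_hom (B B' : nzRingType) (f : B -> B') : is_ring_hom f -> zmod_morphism f.
Proof. by move=> /ring_hom_bundle[g ->]; exact: rmorphB. Qed.
Let is_monoid_morphism_hom (B B' : nzRingType) (f : B -> B') : is_ring_hom f -> monoid_morphism f.
Proof. by move=> /ring_hom_bundle[g ->]; split; [exact: rmorph1 | exact: rmorphM]. Qed.

HB.instance Definition _ := GRing.isZmodMorphism.Build R T (tR T) (is_zmod_morphism_hom (tR_hom T)).
HB.instance Definition _ := GRing.isMonoidMorphism.Build R T (tR T) (is_monoid_morphism_hom (tR_hom T)).
HB.instance Definition _ := GRing.isZmodMorphism.Build A T (tA T) (is_zmod_morphism_hom (tA_hom T)).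
HB.instance Definition _ := GRing.isMonoidMorphism.Build A T (tA T) (is_monoid_morphism_hom (tA_hom T)).

Lemma tR_cR c : tR T (cR c) = tA T c%:A.
Proof. exact: t_compat. Qed.

Lemma t_hom (S : comNzRingType) (u : {rmorphism R -> S}) (v : {rmorphism A -> S}) :
  (forall c, u (cR c) = v c%:A) ->
  exists h : {rmorphism T -> S}, (forall r, h (tR T r) = u r) /\ (forall b, h (tA T b) = v b).
Proof.
move=> uv; have [h [hh hu hv _]] :=
  t_univ T (rmorph_is_ring_hom u) (rmorph_is_ring_hom v) uv.
by have [g gE] := ring_hom_bundle hh; exists g; rewrite -gE.
Qed.

Lemma t_ext (S : comNzRingType) (g g' : {rmorphism T -> S}) :
  (forall r, g (tR T r) = g' (tR T r)) -> (forall b, g (tA T b) = g' (tA T b)) -> g =1 g'.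
Proof.
move=> gR gA x.
have [h [_ _ _ hu]] := t_univ T (rmorph_is_ring_hom (g \o tR T))
  (rmorph_is_ring_hom (g \o tA T)) (fun c => congr1 g (tR_cR c)).
transitivity (h x); first by apply: hu => //; exact: rmorph_is_ring_hom.
by apply/esym/hu => [|r|b] /=; rewrite ?gR ?gA //; exact: rmorph_is_ring_hom.
Qed.

Definition tspan (x : T) := exists k (r : nat -> R) (b : nat -> A),
  x = \sum_(i < k) tR T (r i) * tA T (b i).

Lemma tspan_tens r b : tspan (tR T r * tA T b).
Proof. by exists 1%N, (fun=> r), (fun=> b); rewrite big_ord1. Qed.

Lemma tspanD x x' : tspan x -> tspan x' -> tspan (x + x').
Proof.
move=> [k [r [b ->]]] [l [r' [b' ->]]].
exists (k + l)%N, (fun i => if (i < k)%N then r i else r' (i - k)%N),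
  (fun i => if (i < k)%N then b i else b' (i - k)%N).
rewrite big_split_ord /=; congr (_ + _); apply: eq_bigr => i _.
  by rewrite ltn_ord.
by rewrite ltnNge leq_addr /= addKn.
Qed.

Lemma tspan0 : tspan 0.
Proof. by exists 0%N, (fun=> 0), (fun=> 0); rewrite big_ord0. Qed.

Lemma tspan_sum (I : Type) (s : seq I) (P : pred I) (G : I -> T) :
  (forall i, tspan (G i)) -> tspan (\sum_(i <- s | P i) G i).
Proof. by move=> HG; apply: big_ind => //; [exact: tspan0 | exact: tspanD]. Qed.

Lemma tspan_ind (P : T -> Prop) : P 0 -> (forall x x', P x -> P x' -> P (x + x')) ->
  (forall r b, P (tR T r * tA T b)) -> forall x, tspan x -> P x.
Proof. by move=> P0 PD Pt x [k [r [b ->]]]; apply: big_ind. Qed.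

Lemma tspanN x : tspan x -> tspan (- x).
Proof.
move: x; apply: tspan_ind; first by rewrite oppr0; exact: tspan0.
  by move=> x x' Hx Hx'; rewrite opprD; exact: tspanD.
by move=> r b; rewrite -mulNr -rmorphN; exact: tspan_tens.
Qed.

Lemma tspanM x x' : tspan x -> tspan x' -> tspan (x * x').
Proof.
move=> [k [r [b ->]]] [l [r' [b' ->]]].
rewrite mulr_suml; apply: tspan_sum => i; rewrite mulr_sumr; apply: tspan_sum => j.
by rewrite mulrACA -!rmorphM; exact: tspan_tens.
Qed.

(* By the universal property T retracts onto the subring of sums of pure tensors. *)
Lemma tspan_all x : tspan x.
Proof.
have s1 : tspan 1 by have := tspan_tens 1 1; rewrite !rmorph1 mulr1.
have [S [i [injS inS onS]]] := subring_exists s1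
  (fun x x' Hx Hx' => tspanD Hx (tspanN Hx')) tspanM.
have exR r : exists w, i w = tR T r.
  by apply: onS; have := tspan_tens r 1; rewrite rmorph1 mulr1.
have exA b : exists w, i w = tA T b.
  by apply: onS; have := tspan_tens 1 b; rewrite rmorph1 mul1r.
have [u uE] := choice exR; have [v vE] := choice exA.
have uh : is_ring_hom u.
  split=> [r r'|r r'|]; apply: injS; rewrite ?rmorphD ?rmorphM ?rmorph1 !uE;
  by rewrite ?rmorphD ?rmorphM ?rmorph1.
have vh : is_ring_hom v.
  split=> [r r'|r r'|]; apply: injS; rewrite ?rmorphD ?rmorphM ?rmorph1 !vE;
  by rewrite ?rmorphD ?rmorphM ?rmorph1.
have [u' u'E] := ring_hom_bundle uh; have [v' v'E] := ring_hom_bundle vh.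
have [|h [hR hA]] := t_hom (u := u') (v := v').
  by move=> c; apply: injS; rewrite -u'E -v'E uE vE tR_cR.
have <- : i (h x) = x.
  apply: (t_ext (g := i \o h) (g' := idfun)) => [r|b] /=.
    by rewrite hR -u'E uE.
  by rewrite hA -v'E vE.
exact: inS.
Qed.

Lemma t_ind (P : T -> Prop) : (forall x x', P x -> P x' -> P (x + x')) ->
  (forall r b, P (tR T r * tA T b)) -> forall x, P x.
Proof.
move=> PD Pt x; apply: (tspan_ind _ PD Pt (tspan_all x)).
by have := Pt 0 0; rewrite rmorph0 mul0r.
Qed.

(* A derivation is the second component of a ring morphism to the dual numbers. *)
Lemma t_derivation (th : R -> R) : (forall x x', th (x - x') = th x - th x') ->
  (forall x x', th (x * x') = th x * x' + x * th x') -> (forall c, th (cR c) = 0) ->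
  exists thT : T -> T, [/\ forall x x', thT (x + x') = thT x + thT x',
    forall x x', thT (x * x') = thT x * x' + x * thT x',
    forall r, thT (tR T r) = tR T (th r) & forall b, thT (tA T b) = 0].
Proof.
move=> thB thM thC.
pose u r : dual_numbers T := (tR T r, tR T (th r)).
pose v b : dual_numbers T := (tA T b, 0).
have th0 : th 0 = 0 by have := thB 0 0; rewrite subr0 subrr.
have thD x x' : th (x + x') = th x + th x'.
  by rewrite -{1}[x']opprK thB -[- x']sub0r thB th0 sub0r opprK.
have uh : is_ring_hom u.
  split=> [r r'|r r'|].
  - by rewrite /u thD !rmorphD.
  - by rewrite /u thM rmorphD !rmorphM dual_mulE /= addrC.
  - by rewrite /u -(rmorph1 (@cR R)) thC rmorph0 rmorph1 rmorph1.
have vh : is_ring_hom v.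
  split=> [r r'|r r'|].
  - by rewrite /v rmorphD; congr (_, _); rewrite addr0.
  - by rewrite /v rmorphM dual_mulE /= mulr0 mul0r addr0.
  - by rewrite /v rmorph1.
have [u' u'E] := ring_hom_bundle uh; have [v' v'E] := ring_hom_bundle vh.
have [|h [hR hA]] := t_hom (u := u') (v := v').
  by move=> c; rewrite -u'E -v'E /u /v thC rmorph0 tR_cR.
have h1h : is_ring_hom (fun x => (h x).1).
  by split=> [x x'|x x'|]; rewrite ?rmorphD ?rmorphM ?rmorph1.
have [g gE] := ring_hom_bundle h1h.
(* By uniqueness the first component is the identity, which turns the product of dual numbers into
   the Leibniz rule. *)
have h1 x : (h x).1 = x.
  rewrite -[LHS]/((fun x => (h x).1) x) gE.
  apply: (t_ext (g' := idfun)) => [r|b] /=; rewrite -gE.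
    by rewrite hR -u'E.
  by rewrite hA -v'E.
exists (fun x => (h x).2); split.
- by move=> x x'; rewrite rmorphD.
- by move=> x x'; rewrite rmorphM dual_mulE /= !h1 addrC.
- by move=> r; rewrite hR -u'E.
- by move=> b; rewrite hA -v'E.
Qed.

End Tensor.

(** * Constants of R (x) A *)

Section Constants.
Variables (q a : C) (n : nat) (R : comAlgType F) (s : {rmorphism R -> R}) (th : R -> R).
Variables (y z : R).
Hypotheses (n1 : (1 < n)%N) (qn : n.-primitive_root q) (E : euler_PV q a s th y z).

(** For irrational a there are no relations and y may be sent to 1; for rational a it is sent to an
    m-th root of the germ of b. *)
Lemma germ_hom (A : comAlgType C) :
  exists u : {rmorphism R -> germs A}, forall f, u (in_alg R f) = germF A f.
Proof.
have [[r ar]|na] := pselect (exists r : rat, a = ratr r); last first.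
  have [|p /(horner_eq0_irrational qn E na) ->|h [hF _ _]] :=
    PV_hom E (u := germF A) (eta := 1) (eta' := 1); first by rewrite mulr1.
    by rewrite rmorph0 horner0.
  by exists h.
have [m [b [m0 b0 yb Hp]]] := horner_eq0_rational n1 qn E ar.
have [eta etaE] := germF_root A b m0.
have etaV : eta * (eta ^+ m.-1 * germF A b^-1) = 1.
  by rewrite mulrA -exprS prednK // etaE -rmorphM mulfV // rmorph1.
have [p /Hp[p' ->]|h [hF _ _]] := PV_hom E (u := germF A) etaV; last by exists h.
rewrite rmorphM rmorphB /= map_polyXn map_polyC hornerM !hornerE etaE.
by rewrite subrr mulr0.
Qed.

Variables (A : comAlgType C) (T : tensor R A).

(** Together with constant sequences, [germ_hom] induces a map from T to germs whose restriction to
    A is injective. *)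
Lemma tA_inj : injective (tA T).
Proof.
have [u uF] := germ_hom A.
pose v (b : A) : germs A := germ (fun=> b).
have vh : is_ring_hom v.
  split=> [b b'|b b'|].
  - by rewrite /v -(rmorphD (@germ A)).
  - by rewrite /v -(rmorphM (@germ A)).
  - by rewrite -(rmorph1 (@germ A)).
have [v' v'E] := ring_hom_bundle vh.
have [|h [_ hA]] := t_hom T (u := u) (v := v').
  by move=> c; rewrite uF germF_cF -v'E.
move=> b b' bb; have : v b = v b' by rewrite v'E -!hA bb.
by move=> /germP[N /(_ N (leqnn N))].
Qed.

Variables (sT : {rmorphism T -> T}) (thT : T -> T).
Hypotheses (sTR : forall r, sT (tR T r) = tR T (s r)) (sTA : forall b, sT (tA T b) = tA T b).
Hypotheses (thTD : forall x x', thT (x + x') = thT x + thT x')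
  (thTM : forall x x', thT (x * x') = thT x * x' + x * thT x')
  (thTR : forall r, thT (tR T r) = tR T (th r)) (thTA : forall b, thT (tA T b) = 0).

Definition lin_indep (k : nat) (b : nat -> A) := forall c : nat -> C,
  \sum_(i < k) (c i)%:A * b i = 0 -> forall i, (i < k)%N -> c i = 0.

Lemma sT_tens r b : sT (tR T r * tA T b) = tR T (s r) * tA T b.
Proof. by rewrite rmorphM sTR sTA. Qed.

Lemma thT_tens r b : thT (tR T r * tA T b) = tR T (th r) * tA T b.
Proof. by rewrite thTM thTR thTA mulr0 addr0. Qed.

Lemma thT0 : thT 0 = 0.
Proof. by rewrite -(rmorph0 (tA T)) thTA rmorph0. Qed.

Lemma thT_sum (I : Type) (l : seq I) P (G : I -> T) :
  thT (\sum_(i <- l | P i) G i) = \sum_(i <- l | P i) thT (G i).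
Proof. by apply: (big_morph thT); [exact: thTD | exact: thT0]. Qed.

Lemma const_coef (r : nat -> R) k :
  (forall i, (i < k)%N -> s (r i) = r i) -> (forall i, (i < k)%N -> th (r i) = 0) ->
  exists c : nat -> C, forall i, (i < k)%N -> r i = cR (c i).
Proof.
move=> rs rt; have ex i : exists c, (i < k)%N -> r i = cR c.
  case: (ltnP i k) => [ik|_]; last by exists 0.
  by have [c ->] := ep_const E (rs i ik) (rt i ik); exists c.
by have [c cE] := choice ex; exists c.
Qed.

(* The coefficients of the last basis element in such relations form an ideal stable under
   [s] and [th]; if it contained 1, all other coefficients would be constant. *)
Lemma lin_indep_tens k (b : nat -> A) : lin_indep k b -> forall r : nat -> R,
  \sum_(i < k) tR T (r i) * tA T (b i) = 0 -> forall i, (i < k)%N -> r i = 0.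
Proof.
elim: k b => [//|k IH] b fb.
have fb' : lin_indep k b.
  move=> c Ec i ik; pose c' j := if (j < k)%N then c j else 0.
  have : \sum_(j < k.+1) (c' j)%:A * b j = 0.
    rewrite big_ord_recr /= {2}/c' ltnn scale0r mul0r addr0 -[RHS]Ec.
    by apply: eq_bigr => j _; rewrite /c' ltn_ord.
  by move=> /fb/(_ i (ltnW ik)); rewrite /c' ik.
have {}IH := IH b fb'.
pose I x := exists r : nat -> R,
  \sum_(i < k) tR T (r i) * tA T (b i) + tR T x * tA T (b k) = 0.
have [| | | | |I0|I1] := ep_simple E (I := I).
- exists (fun=> 0); rewrite rmorph0 mul0r addr0 big1 // => i _.
  by rewrite ?rmorph0 mul0r.
- move=> x x' [r Er] [r' Er']; exists (fun i => r i - r' i).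
  rewrite -[RHS](subrr 0) -[X in _ = X - _]Er -[X in _ = _ - X]Er' opprD addrACA -sumrB rmorphB mulrBl; congr (_ + _).
  by apply: eq_bigr => i _; rewrite rmorphB mulrBl.
- move=> w x [r Er]; exists (fun i => w * r i).
  have := congr1 ( *%R (tR T w)) Er; rewrite mulr0 => E1.
  rewrite -[RHS]E1 mulrDr mulr_sumr rmorphM -mulrA; congr (_ + _).
  by apply: eq_bigr => i _; rewrite rmorphM mulrA.
- move=> x [r Er]; exists (fun i => s (r i)).
  have := congr1 sT Er; rewrite rmorph0 => E1.
  rewrite -[RHS]E1 rmorphD rmorph_sum sT_tens; congr (_ + _).
  by apply: eq_bigr => i _; rewrite sT_tens.
- move=> x [r Er]; exists (fun i => th (r i)).
  have := congr1 thT Er; rewrite thT0 => E1.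
  rewrite -[RHS]E1 thTD thT_sum thT_tens; congr (_ + _).
  by apply: eq_bigr => i _; rewrite thT_tens.
- move=> r; rewrite big_ord_recr /= => Er.
  have rk : r k = 0 by apply: I0; exists r.
  move: Er; rewrite rk rmorph0 mul0r addr0 => /IH Er i.
  by rewrite ltnS leq_eqVlt => /orP[/eqP ->|/Er].
have [r Er] := I1 1.
(* The last coefficient 1 is fixed by [s] and killed by [th], so both operators lead to relations of
   length k. *)
have rs i : (i < k)%N -> s (r i) = r i.
  move=> ik; apply/eqP; rewrite -subr_eq0; apply/eqP; move: i ik.
  apply: (IH (fun i => s (r i) - r i)).
  have := congr1 sT Er; rewrite rmorphD rmorph_sum sT_tens rmorph0 rmorph1 -[in RHS]Er.
  move=> /addIr Es; under eq_bigr do rewrite rmorphB mulrBl.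
  rewrite sumrB -Es; apply/eqP; rewrite subr_eq0; apply/eqP.
  by apply: eq_bigr => i _; rewrite sT_tens.
have rt i : (i < k)%N -> th (r i) = 0.
  move: i; apply: (IH (fun i => th (r i))).
  have := congr1 thT Er; rewrite thTD thT_sum thT_tens thT0.
  rewrite -(rmorph1 (@cR R)) (th_cR E) rmorph0 mul0r addr0 => Et.
  by rewrite -[RHS]Et; apply: eq_bigr => i _; rewrite thT_tens.
have [c rc] := const_coef rs rt.
(* A relation with constant coefficients pulls back to A along the injective [tA T]; its last
   coefficient 1 contradicts independence. *)
pose c' j := if (j < k)%N then c j else 1.
have : \sum_(j < k.+1) (c' j)%:A * b j = 0.
  apply: tA_inj; rewrite rmorph0 -[RHS]Er big_ord_recr /= {2}/c' ltnn scale1r mul1r.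
  rewrite rmorphD rmorph_sum rmorph1 mul1r; congr (_ + _).
  by apply: eq_bigr => j _; rewrite /c' ltn_ord rc // rmorphM tR_cR.
by move=> /fb/(_ k (leqnn _))/eqP; rewrite /c' ltnn oner_eq0.
Qed.

(** Induction on the number of pure tensors. When the elements of A are independent over [C], each
    coefficient inherits invariance and is a constant of R, which can be moved across to A. *)
Lemma tens_const x : sT x = x -> thT x = 0 -> exists b, x = tA T b.
Proof.
have [k [r [b]]] := tspan_all x; elim: k r b => [|k IH] r b xE sx tx.
  by exists 0; rewrite xE big_ord0 rmorph0.
have [fb|] := pselect (lin_indep k.+1 b).
  have rs i : (i < k.+1)%N -> s (r i) = r i.
    move=> ik; apply/eqP; rewrite -subr_eq0; apply/eqP; move: i ik.
    apply: (lin_indep_tens fb (r := fun i => s (r i) - r i)).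
    under eq_bigr do rewrite rmorphB mulrBl.
    rewrite sumrB -xE -[in X in _ - X]sx xE rmorph_sum; apply/eqP; rewrite subr_eq0; apply/eqP.
    by apply: eq_bigr => i _; rewrite sT_tens.
  have rt i : (i < k.+1)%N -> th (r i) = 0.
    move: i; apply: (lin_indep_tens fb (r := fun i => th (r i))).
    by rewrite -[RHS]tx xE thT_sum; apply: eq_bigr => i _; rewrite thT_tens.
  have [c rc] := const_coef rs rt.
  exists (\sum_(i < k.+1) (c i)%:A * b i); rewrite xE rmorph_sum.
  by apply: eq_bigr => i _; rewrite rc // rmorphM tR_cR.
move=> /existsNP[c /not_implyP[Ec /existsNP[j /not_implyP[jk /eqP cj]]]].
pose j' := Ordinal jk.
(* Solve the dependence relation for b j; [bump j] enumerates the other indices, so one tensor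
   disappears. *)
have bj : tA T (b j) = - \sum_(i < k) tR T (cR (c (bump j i) / c j)) * tA T (b (bump j i)).
  move: Ec; rewrite (bigD1_ord j') //= => /(congr1 (fun x => tA T ((c j)^-1%:A * x))).
  rewrite mulr0 rmorph0 mulrDr mulrA -scalerAl mul1r scalerA mulVf // scale1r mul1r.
  rewrite rmorphD => /eqP; rewrite addr_eq0 => /eqP ->; congr (- _).
  rewrite mulr_sumr rmorph_sum; apply: eq_bigr => i _.
  by rewrite tR_cR -rmorphM !mulr_algl scalerA [_^-1 * _]mulrC.
apply: (IH (fun i => r (bump j i) - r j * cR (c (bump j i) / c j)) (fun i => b (bump j i))) => //.
rewrite xE (bigD1_ord j') //= bj mulrN addrC mulr_sumr -sumrB; apply: eq_bigr => i _.
by rewrite rmorphB mulrBl (rmorphM (tR T)) mulrA.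
Qed.

End Constants.

(** * The Galois functor *)

Section Galois.
Variables (q a : C) (n : nat) (R : comAlgType F) (s : {rmorphism R -> R}) (d : nat -> R -> R).
Variables (y : R).
Hypotheses (n1 : (1 < n)%N) (qn : n.-primitive_root q) (H : PV_ring q n a s d y).

Let th := eulerT q n s d.
Variable z : R.
Hypothesis E : euler_PV q a s th y z.

Let H0 : IDq_ring q s d := pv_IDq H.

(** The line F w is stable under d^(1) and d^(n), hence under all d^(k). Applied to monomials in y
    and z, it shows that rescaling y by an element of A commutes with every d^(k). *)
Lemma inF_mul_d (w : R) e : s w = w -> th w = cR e * w ->
  forall k x, inF x -> exists x', inF x' /\ d k (x * w) = x' * w.
Proof.
move=> sw tw k x xF.
pose P (j : nat) (v : R) := exists x', inF x' /\ v = x' * w.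
have d1P j v : P j v -> forall j', P j' (d 1 v).
  move=> [x' [x'F ->]] j'; rewrite (d1E H0); exists (in_alg R (cF (q - 1) * tF)^-1 * (s x' - x')).
  split; last by rewrite rmorphM sw; ring.
  by apply: inF_M; [exists (cF (q - 1) * tF)^-1 | apply: inF_B => //; exact: (inF_s qn E)].
have dnP j v : P j v -> forall j', P j' (d n v).
  move=> [x' [x'F ->]] j'; rewrite (dnE q s d n1) -/th (ep_M E) tw.
  exists (in_alg R (n%:R * tF ^+ n)^-1 * (th x' + cR e * x' - eulerE q n s x')); split.
    apply: inF_M; first by exists (n%:R * tF ^+ n)^-1.
    apply: inF_B.
      rewrite -[th x']opprK addrC -[- th x']sub0r; apply: inF_B.
        by apply: inF_M => //; exact: inF_cR.
      by apply: inF_B; [exists 0; rewrite rmorph0 | exact: (inF_th E)].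
    have inFi i : inF (iter i s x').
      by elim: i => //= i; exact: (inF_s qn E).
    rewrite /eulerE; apply: big_ind => [|u v' uF vF|i _].
    - by exists 0; rewrite rmorph0.
    - rewrite -[v']opprK -[- v']sub0r; apply: inF_B => //; apply: inF_B => //.
      by exists 0; rewrite rmorph0.
    - by apply: inF_M => //; exact: inF_cR.
  by rewrite (eulerE_mul_inv q n x' sw); ring.
have cP c j v : P j v -> forall j', P j' (cR c * v).
  move=> [x' [x'F ->]] j'; exists (cR c * x'); rewrite mulrA; split=> //.
  by apply: inF_M => //; exact: inF_cR.
have P0 j : P j (x * w) by exists x.
apply: (d_ind n1 qn H0 (P := P)) => //.
- exact: dnP (P0 0%N) _.
- by move=> j v _ Pv; apply: cP (d1P _ _ Pv j.+1) _.
- by move=> l v Pv; apply: cP (dnP _ _ Pv 0%N) _.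
Qed.

Section Group.
Variables (A : comAlgType C) (T : tensor R A).

(** Commutation in [in_Gal] concerns any additive map with the right values on pure tensors; such
    maps are built for d^(1) and d^(n) from the extensions of [s] and [th]. Hence g y is s-invariant
    with rate a, like y, and (g y) z is a constant, so it lies in A. *)
Lemma gal_y (g : T -> T) : in_Gal d g -> exists c, g (tR T y) = tR T y * tA T c.
Proof.
move=> [gh _ gF _ gD]; have [g' gE] := ring_hom_bundle gh.
have sc c : s (cR c) = cR c by exact: s_cR H0 c.
have [|sT [sTR sTA]] := t_hom T (u := tR T \o s) (v := tA T).
  by move=> c; rewrite /= sc tR_cR.
have [thT [thTD thTM thTR thTA]] := t_derivation T (ep_B E) (ep_M E) (th_cR E).
have iT i r b : iter i sT (tR T r * tA T b) = tR T (iter i s r) * tA T b.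
  by elim: i => //= i ->; rewrite rmorphM sTR sTA.
have iD i x x' : iter i sT (x + x') = iter i sT x + iter i sT x'.
  by elim: i => //= i ->; rewrite rmorphD.
pose al := in_alg R (cF (q - 1) * tF)^-1; pose be := in_alg R (n%:R * tF ^+ n)^-1.
pose D1 x := tR T al * (sT x - x).
pose ET x := \sum_(j < n) tR T (cR (euler_coef q n j)) * iter j sT x.
pose Dn x := tR T be * (thT x - ET x).
have ETD x x' : ET (x + x') = ET x + ET x'.
  by rewrite /ET -big_split; apply: eq_bigr => j _; rewrite iD mulrDr.
have D1g x : D1 (g x) = g (D1 x).
  apply: (gD 1%N) => [x1 x2|r b]; rewrite /D1; first by rewrite rmorphD; ring.
  by rewrite rmorphM sTR sTA (d1E H0) (rmorphM (tR T)) (rmorphB (tR T)) /= /al; ring.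
have Dng x : Dn (g x) = g (Dn x).
  apply: (gD n) => [x1 x2|r b]; rewrite /Dn; first by rewrite thTD ETD; ring.
  rewrite (dnE q s d n1) -/th thTM thTR thTA mulr0 addr0 (rmorphM (tR T)) (rmorphB (tR T)) /eulerE.
  rewrite (rmorph_sum (tR T)) -mulrA mulrBl; congr (_ * (_ - _)).
  by rewrite mulr_suml; apply: eq_bigr => j _; rewrite iT (rmorphM (tR T)) mulrA.
have q1 := prim_neq1 qn n1.
have alK : in_alg R (cF (q - 1) * tF) * al = 1.
  rewrite -rmorphM mulfV ?rmorph1 //; apply: mulf_neq0 tF_neq0.
  by apply: cF_neq0; rewrite subr_eq0.
have ntF0 := ntF_neq0 (ltnW n1).
have beK : in_alg R (n%:R * tF ^+ n) * be = 1 by rewrite -rmorphM mulfV ?rmorph1.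
have tR0 (x : R) w w' : x * w = 1 -> tR T w * w' = 0 -> w' = 0.
  by move=> xw E1; rewrite -[w']mul1r -(rmorph1 (tR T)) -xw rmorphM -mulrA E1 mulr0.
pose Y := g (tR T y).
have sY : sT Y = Y.
  apply/eqP; rewrite -subr_eq0; apply/eqP; apply: (tR0 _ _ _ alK).
  rewrite -/(D1 Y) D1g /D1 sTR /= (ep_sy E) subrr mulr0 gE; exact: rmorph0.
(* This is [euler_coefP] for i = 0: the coefficients add up to 0. *)
have ETinv x : sT x = x -> ET x = 0.
  move=> sx; have := euler_coefP n1 qn (ltnW n1); rewrite /ET.
  under eq_bigr do rewrite mul0n expr0 mulr1.
  move=> e0; rewrite (eq_bigr (fun j : 'I_n => tR T (cR (euler_coef q n j)) * x)).
    by rewrite -mulr_suml -!rmorph_sum e0 !rmorph0 mul0r.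
  by move=> j _; congr (_ * _); elim: (nat_of_ord j) => //= k ->.
have tY : thT Y = tR T (cR a) * Y.
  apply/eqP; rewrite -subr_eq0; apply/eqP; apply: (tR0 _ _ _ beK).
  have := Dng (tR T y); rewrite /Dn !ETinv // ?sTR /= ?(ep_sy E) // !subr0 -/Y => E1.
  rewrite mulrBr E1 thTR (ep_thy E) gE !rmorphM -!gE gF -/Y.
  have -> : g (tR T (cR a)) = tR T (cR a) by exact: gF.
  by rewrite subrr.
have [||c cE] := tens_const n1 qn E (x := Y * tR T z) sTR sTA thTD thTM thTR thTA.
- by rewrite rmorphM sY sTR /= (s_z E).
- by rewrite thTM tY thTR (th_z E) rmorphM !rmorphN; ring.
exists c; rewrite -cE mulrCA -rmorphM (ep_yz E) rmorph1 mulr1 //.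
Qed.

Lemma gal_exists (c c' : A) : c * c' = 1 ->
  (forall p : {poly F}, (map_poly (in_alg R) p).[y] = 0 ->
    (map_poly (tR T \o in_alg R) p).[tR T y * tA T c] = 0) ->
  exists g : {rmorphism T -> T}, [/\ forall f, g (tR T (in_alg R f)) = tR T (in_alg R f),
    forall b, g (tA T b) = tA T b, g (tR T y) = tR T y * tA T c &
    g (tR T z) = tR T z * tA T c'].
Proof.
move=> cc rel.
have cc' : (tR T y * tA T c) * (tR T z * tA T c') = 1.
  by rewrite mulrACA -!rmorphM (ep_yz E) cc !rmorph1 mulr1.
have [h [hF hy hz]] := PV_hom E (u := tR T \o in_alg R) cc' rel.
have [|g [gR gA]] := t_hom T (u := h) (v := tA T).
  by move=> e; rewrite hF /= -tR_cR.
by exists g; split=> [f|b||]; rewrite ?gR ?gA ?hF.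
Qed.

Lemma gal_monomial (g : {rmorphism T -> T}) (c c' : A) :
  (forall f, g (tR T (in_alg R f)) = tR T (in_alg R f)) ->
  g (tR T y) = tR T y * tA T c -> g (tR T z) = tR T z * tA T c' ->
  forall f i N, g (tR T (in_alg R f * (z ^+ N * y ^+ i))) =
    tR T (in_alg R f * (z ^+ N * y ^+ i)) * tA T (c' ^+ N * c ^+ i).
Proof.
move=> gF gy gz f i N.
rewrite (rmorphM (tR T)) rmorphM gF (rmorphM (tR T)) rmorphM !(rmorphXn (tR T)) !rmorphXn gy gz.
by rewrite !exprMn (rmorphM (tA T)) !(rmorphXn (tA T)); ring.
Qed.

Lemma R_ind (P : R -> Prop) : P 0 -> (forall x x', P x -> P x' -> P (x + x')) ->
  (forall f i N, P (in_alg R f * (z ^+ N * y ^+ i))) -> forall x, P x.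
Proof.
move=> P0 PD Pw x; have [N [p ->]] := ep_gen E x.
rewrite horner_coef mulr_sumr; apply: big_ind => // i _.
by rewrite coef_map mulrCA; apply: Pw.
Qed.

(** The map g' rescales by the inverse of c, so it inverts g. Both are checked on the monomials f
    z^N y^i, where g is multiplication by an element of A and [inF_mul_d] gives commutation. *)
Lemma gal_extension_in_Gal (g g' : {rmorphism T -> T}) (c c' : A) : c * c' = 1 ->
  (forall f, g (tR T (in_alg R f)) = tR T (in_alg R f)) ->
  (forall f, g' (tR T (in_alg R f)) = tR T (in_alg R f)) ->
  (forall b, g (tA T b) = tA T b) -> (forall b, g' (tA T b) = tA T b) ->
  g (tR T y) = tR T y * tA T c -> g' (tR T y) = tR T y * tA T c' ->
  g (tR T z) = tR T z * tA T c' -> g' (tR T z) = tR T z * tA T c ->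
  in_Gal d g.
Proof.
move=> cc gF gF' gA gA' gy gy' gz gz'.
have gw := gal_monomial gF gy gz; have gw' := gal_monomial gF' gy' gz'.
have canc (h h' : {rmorphism T -> T}) e e' : e * e' = 1 ->
    (forall b, h (tA T b) = tA T b) -> (forall b, h' (tA T b) = tA T b) ->
    (forall f i N, h (tR T (in_alg R f * (z ^+ N * y ^+ i))) =
      tR T (in_alg R f * (z ^+ N * y ^+ i)) * tA T (e' ^+ N * e ^+ i)) ->
    (forall f i N, h' (tR T (in_alg R f * (z ^+ N * y ^+ i))) =
      tR T (in_alg R f * (z ^+ N * y ^+ i)) * tA T (e ^+ N * e' ^+ i)) ->
    cancel h h'.
  move=> ee hA hA' hw hw'; apply: (t_ext (g := h' \o h) (g' := idfun)) => [|b] /=; last by rewrite hA hA'.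
  apply: R_ind => [|x x' Hx Hx'|f i N]; first by rewrite !rmorph0.
    by rewrite (rmorphD (tR T)) !rmorphD Hx Hx'.
  rewrite hw rmorphM hA' hw' -mulrA -rmorphM mulrACA -!exprMn ee [e' * e]mulrC ee.
  by rewrite !expr1n mulr1 rmorph1 mulr1.
split; first exact: rmorph_is_ring_hom.
- exists g'; first exact: canc cc _ _ gw gw'.
  by apply: canc gw' gw => //; rewrite mulrC.
- exact: gF.
- exact: gA.
move=> k D DD Dt.
have D0 : D 0 = 0 by apply: (addrI (D 0)); rewrite -DD !addr0.
apply: t_ind => [x x' Hx Hx'|r b]; first by rewrite rmorphD !DD Hx Hx' rmorphD.
move: r; apply: R_ind => [|x x' Hx Hx'|f i N].
- by rewrite (rmorph0 (tR T)) mul0r rmorph0 !D0 rmorph0.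
- by rewrite (rmorphD (tR T)) mulrDl rmorphD !DD Hx Hx' rmorphD.
have [e te] : exists e, th (z ^+ N * y ^+ i) = cR e * (z ^+ N * y ^+ i).
  exists (- a * N%:R + a * i%:R); rewrite (ep_M E) (th_X E _ (th_z E)) (th_X E _ (ep_thy E)).
  by rewrite rmorphD; ring.
have sw : s (z ^+ N * y ^+ i) = z ^+ N * y ^+ i.
  by rewrite rmorphM !rmorphXn (s_z E) (ep_sy E).
have [_ [[f' ->] df]] := inF_mul_d sw te k (ex_intro _ f (erefl (in_alg R f))).
rewrite rmorphM gw gA -mulrA -rmorphM !Dt df [RHS]rmorphM gw gA.
by rewrite (rmorphM (tA T)) mulrA.
Qed.

End Group.

Lemma in_Gal_inv (A : comAlgType C) (T : tensor R A) (g : T -> T) : in_Gal d g ->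
  exists g', in_Gal d g' /\ cancel g' g.
Proof.
move=> [[gD gM g1] [g' gK g'K] gF gA gC]; exists g'; split=> //; split.
- by split=> [x x'|x x'|]; apply: (can_inj gK); rewrite ?gD ?gM ?g1 !g'K.
- by exists g.
- by move=> f; apply: (can_inj gK); rewrite g'K gF.
- by move=> x; apply: (can_inj gK); rewrite g'K gA.
- by move=> k D DD Dt x; apply: (can_inj gK); rewrite g'K -(gC k) ?g'K.
Qed.

(** Reduces the computation of the functor to finding the possible scalars c = g(y) / y: they must
    lie in P, and conversely every element of P must be a unit compatible with the relations of
    y. *)
Lemma Gal_iso_units (P : forall A : comAlgType C, A -> Prop) :
  (forall (A : comAlgType C) (T : tensor R A) g c, in_Gal d g ->
     g (tR T y) = tR T y * tA T c -> P A c) ->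
  (forall (A : comAlgType C) (c : A), P A c -> exists c', [/\ c * c' = 1, P A c' &
     forall (e : A) (T : tensor R A), P A e -> forall p : {poly F}, (map_poly (in_alg R) p).[y] = 0 ->
    (map_poly (tR T \o in_alg R) p).[tR T y * tA T e] = 0]) ->
  Gal_iso d P.
Proof.
move=> Pg gP.
(* By [gal_y] the default 0 is never taken on the Galois group. *)
pose Phi (A : comAlgType C) (T : tensor R A) (g : T -> T) : A :=
  if pselect (exists c, g (tR T y) = tR T y * tA T c) is left e then projT1 (cid e) else 0.
have PhiE (A : comAlgType C) (T : tensor R A) (g : T -> T) :
    in_Gal d g -> g (tR T y) = tR T y * tA T (Phi A T g).
  by move=> /gal_y gy; rewrite /Phi; case: pselect => // e; case: (cid e).
(* The scalar is unique, since y is a unit and [tA T] is injective; this yields multiplicativity and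
   naturality. *)
have inj (A : comAlgType C) (T : tensor R A) (c c' : A) :
    tR T y * tA T c = tR T y * tA T c' -> c = c'.
  move=> /(congr1 ( *%R (tR T z))); rewrite !mulrA -!rmorphM [z * y]mulrC (ep_yz E).
  by rewrite rmorph1 !mul1r; exact: (tA_inj n1 qn E).
exists Phi; split.
- by move=> A T g gG; apply: (Pg A T g) => //; exact: PhiE.
- move=> A T g h gG hG.
  have [gh gb gF gA gD] := gG; have [hh hb hF hA hD] := hG.
  have ghG : in_Gal d (g \o h).
    split; [|exact: bij_comp| | |].
    + have [g' ->] := ring_hom_bundle gh; have [h' ->] := ring_hom_bundle hh.
      exact: (rmorph_is_ring_hom (g' \o h')).
    + by move=> f /=; rewrite hF gF.
    + by move=> x /=; rewrite hA gA.
    + by move=> k D DD Dt x /=; rewrite (gD k D DD Dt) (hD k D DD Dt).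
  apply: (inj A T); rewrite -(PhiE _ _ _ ghG) /= (PhiE _ _ _ hG).
  case: gh => _ gM _; rewrite gM gA (PhiE _ _ _ gG) rmorphM; ring.
- move=> A T g h gG hG Egh.
  have [gh gb gF gA gD] := gG; have [hh hb hF hA hD] := hG.
  have gy := PhiE _ _ _ gG; have hy := PhiE _ _ _ hG.
  have [g' gE] := ring_hom_bundle gh; have [h' hE] := ring_hom_bundle hh.
  move: gF gA gy hF hA hy; rewrite Egh gE hE => gF gA gy hF hA hy.
  have gz : g' (tR T z) = h' (tR T z).
    have e1 : g' (tR T y) * g' (tR T z) = 1 by rewrite -rmorphM -(rmorphM (tR T)) (ep_yz E) !rmorph1.
    have e2 : g' (tR T y) * h' (tR T z) = 1.
      by rewrite gy -hy -rmorphM -(rmorphM (tR T)) (ep_yz E) !rmorph1.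
    by rewrite -[LHS]mul1r -e2 mulrAC e1 mul1r.
  apply: t_ext => [|b]; last by rewrite gA hA.
  apply: R_ind => [|x x' Hx Hx'|f i N]; first by rewrite !rmorph0.
    by rewrite !rmorphD Hx Hx'.
  rewrite !(rmorphM (tR T)) !rmorphM !(rmorphXn (tR T)) !rmorphXn gz gy hy.
  by congr (_ * _); rewrite -/(in_alg R f) (gF f) (hF f).
- move=> A T c Pc; have [c' [cc Pc' rel]] := gP A c Pc.
  have [g [gF gA gy gz]] := gal_exists cc (rel c T Pc).
  have cc' : c' * c = 1 by rewrite mulrC.
  have [g' [gF' gA' gy' gz']] := gal_exists cc' (rel c' T Pc').
  have gG : in_Gal d g := gal_extension_in_Gal cc gF gF' gA gA' gy gy' gz gz'.
  by exists g; split=> //; apply: (inj A T); rewrite -gy -PhiE.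
- move=> A B f fh fC TA TB phi phih phiR phiA g g' gG gG' gg.
  apply: (inj B TB); rewrite -PhiE // -phiR gg PhiE //.
  by case: phih => _ phiM _; rewrite phiM phiR phiA.
Qed.

End Galois.

Theorem theorem4p22 (n : nat) (q a : C) (R : comAlgType F) (s : R -> R)
  (d : nat -> R -> R) (y : R) :
  (2 <= n)%N -> n.-primitive_root q -> PV_ring q n a s d y ->
  ((exists r : rat, a = ratr r) ->
     exists m : nat, (0 < m)%N /\ Gal_iso d (fun A c => c ^+ m = 1)) /\
  (~ (exists r : rat, a = ratr r) ->
     Gal_iso d (fun A c => exists u, c * u = 1)).
Proof.
move=> n1 qn H; have [s' sE] := ring_hom_bundle (s_hom (pv_IDq H)).
rewrite {}sE in H; have [z E] := euler_PV_exists n1 qn H; split.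
  move=> [r ar]; have [m [b [m0 b0 yb Hp]]] := horner_eq0_rational n1 qn E ar.
  exists m; split=> //; apply: (Gal_iso_units n1 qn H E).
    (* As g fixes y^m = b, cancelling y^m leaves c^m = 1. *)
    move=> A T g c [gh _ gF _ _] gy; have inj := tA_inj n1 qn E (T := T).
    apply: inj; rewrite rmorphXn rmorph1.
    have := gF b; rewrite -[b%:A]/(in_alg R b) -yb.
    have [g' gE] := ring_hom_bundle gh.
    rewrite gE !(rmorphXn (tR T)) rmorphXn -gE gy exprMn.
    move=> /(congr1 ( *%R (tR T z ^+ m))); rewrite mulrA -exprMn -rmorphM [z * y]mulrC (ep_yz E).
    by rewrite rmorph1 expr1n mul1r.
  move=> A c cm; exists (c ^+ m.-1); split; first by rewrite -exprS prednK.
    by rewrite -exprM mulnC exprM cm expr1n.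
  (* Every relation is a multiple of X^m - b, which y e satisfies too when e^m = 1. *)
  move=> e T em p /Hp[p' ->].
  rewrite rmorphM rmorphB /= map_polyXn map_polyC hornerM !hornerE exprMn -!rmorphXn.
  by rewrite em rmorph1 mulr1 yb subrr mulr0.
move=> na; apply: (Gal_iso_units n1 qn H E).
  (* The inverse automorphism rescales y by some e, and c e = 1. *)
  move=> A T g c gG gy; have [g' [g'G gg']] := in_Gal_inv gG.
  have [e ge] := gal_y n1 qn H E g'G; exists e.
  have inj := tA_inj n1 qn E (T := T); apply: inj.
  have [[_ gM _] _ _ gA _] := gG.
  have := congr1 g ge; rewrite gg' gM gA gy -mulrA -rmorphM.
  move=> /(congr1 ( *%R (tR T z))); rewrite !mulrA -rmorphM [z * y]mulrC (ep_yz E).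
  by rewrite !rmorph1 mul1r => <-.
move=> A c [c' cc]; exists c'; split=> //; first by exists c; rewrite mulrC.
by move=> e T _ p /(horner_eq0_irrational qn E na) ->; rewrite rmorph0 horner0.
Qed.
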